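(* Let $\beta,\kappa\ge0$ be such that $18^2\alpha_0(\kappa)(2+\alpha_0(\kappa))<1$, and let $\gamma$ be a path with finite support. Then $$\Bigl|\langle L_\gamma(\sigma,\phi)\rangle_{\beta,\kappa,\infty}-\langle L_\gamma(\sigma,\phi)\rangle_{\infty,\kappa,\infty}\Bigr|\le 2K_4\bigl(1+K_3K_4\alpha_0(\kappa)\bigr)\,|\operatorname{supp}\gamma|\,\alpha_0(\kappa)\,\alpha_1(\beta)^6,$$ where $K_3=18^{-3}\bigl(1-18^2(2+\alpha_0(\kappa))\alpha_0(\kappa)\bigr)^{-1}$ and $K_4=18^2(2+\alpha_0(\kappa))$.
   Context: $G=\mathbb{Z}_n$, $n\ge2$, $\rho\colon G\to\mathbb{C}$ a faithful one-dimensional unitary representation. $B_N=[-N,N]^4\cap\mathbb{Z}^4$; $C_k(B_N)$ is the set of oriented $k$-cells of the cubical complex of $\mathbb{Z}^4$ with all corners in $B_N$ (each non-oriented cell gives $c$ and $-c$). $\Omega^k(B_N,G)$: functions $\omega\colon C_k(B_N)\to G$ with $\omega(-c)=-\omega(c)$, extended linearly to integer chains; $d\omega(c)=\omega(\partial c)$. For $\beta,\kappa\ge0$ put on $\Omega^1(B_N,G)\times\Omega^0(B_N,G)$ the probability measure proportional to $\exp(\beta\sum_{p\in C_2(B_N)}\rho(d\sigma(p))+\kappa\sum_{e\in C_1(B_N)}\rho(\sigma(e)-\phi(\partial e)))$ with $\phi(\partial e)=\phi(y)-\phi(x)$ when $\partial e=y-x$; for $\beta=\infty$ the first factor is replaced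 by the indicator of $d\sigma=0$. $\langle f\rangle_{\beta,\kappa,\infty}$ is the $N\to\infty$ limit of the expectation of $f$ (exists for local $f$). A path is a finitely supported $1$-chain $\gamma$ (formal integer combination of positively oriented edges) with coefficients in $\{-1,0,1\}$ such that $\partial\gamma=0$ or $\partial\gamma=x_2-x_1$ for vertices $x_1,x_2$; $\operatorname{supp}\gamma$ is the set of positively oriented edges with non-zero coefficient; $L_\gamma(\sigma,\phi)=\rho(\sigma(\gamma)-\phi(\partial\gamma))$. $\varphi_r(g)=e^{r\operatorname{Re}(\rho(g)-\rho(0))}$, $\alpha_0(r)=\sum_{g\in G\setminus\{0\}}\varphi_r(g)^2$, $\alpha_1(r)=\max_{g\in G\setminus\{0\}}\varphi_r(g)^2$. *)

(* Defs.v *)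
From HB Require Import structures.
From mathcomp Require Import all_boot all_order all_algebra.
From mathcomp Require Import finmap freeg.
From mathcomp Require Import complex.
From mathcomp Require Import all_classical all_reals all_analysis.

Set Implicit Arguments.
Unset Strict Implicit.
Unset Printing Implicit Defensive.

Import Order.TTheory GRing.Theory Num.Theory.
Import numFieldNormedType.Exports.

Local Open Scope ring_scope.
Local Open Scope complex_scope.

(** * The cubical complex of Z^4 *)

Definition vertex := 'rV[int]_4.

Definition unit_vec (j : 'I_4) : vertex := delta_mx 0 j.

(* [(x, J)] is the positively oriented cell with corners
   [x + \sum_(j in I) unit_vec j], [I \subset J]; its dimension is [#|J|]. *)
Definition cell := (vertex * {set 'I_4})%type.

Definition cell_dim (c : cell) : nat := #|c.2|.

Definition corner (c : cell) (I : {set 'I_4}) : vertex :=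
  c.1 + \sum_(j in I) unit_vec j.

Definition cell_of_vertex (x : vertex) : cell := (x, finset.set0).

(* [(c, false)] is the positively oriented cell [c], [(c, true)] is [-c]. *)
Definition ocell := (cell * bool)%type.

Definition opp_ocell (c : ocell) : ocell := (c.1, ~~ c.2).

(* Integer chains; dimensions may be mixed, [is_chain] fixes the dimension. *)
Definition chain := {freeg cell / int}.

Definition is_chain (k : nat) (q : chain) : Prop :=
  {in dom q, forall c, cell_dim c = k}.

(* Cubical boundary; the sign is the position of [j] in the increasing
   enumeration of [J], so an edge [(x, {j})] has boundary
   [(x + e_j) - x]. *)
Definition boundary_cell (c : cell) : chain :=
  \sum_(j in c.2) (-1) ^+ #|[set i in c.2 | (i < j)%N]| *:
    (<< (c.1 + unit_vec j, (c.2 :\ j)%SET) >> - << (c.1, (c.2 :\ j)%SET) >>).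

Definition boundary_ocell (c : ocell) : chain :=
  (-1) ^+ c.2 *: boundary_cell c.1.

Definition boundary (q : chain) : chain :=
  \sum_(c <- dom q) coeff c q *: boundary_cell c.

(** * Boxes and their oriented cells *)

Definition box_point N (f : {ffun 'I_4 -> 'I_N.*2.+1}) : vertex :=
  \row_i ((f i)%:Z - N%:Z).

(* [-N, N]^4 in Z^4 *)
Definition box (N : nat) : {fset vertex} :=
  [fset box_point f | f in {: {ffun 'I_4 -> 'I_N.*2.+1}}]%fset.

Lemma in_box N (x : vertex) :
  (x \in box N) = [forall i, - N%:Z <= x 0 i <= N%:Z].
Proof.
apply/imfsetP/forallP => [[f _ ->] i|xN].
  by rewrite mxE lerBrDr addNr lerBlDr -PoszD lez_nat addnn -ltnS; case: (f i).
have xE i : `|(x ord0 i + N%:Z)%R|%N = x ord0 i + N%:Z :> int.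
  by have /andP[xi _] := xN i; rewrite gez0_abs// -[N%:Z]opprK subr_ge0.
have bnd i : (`|(x ord0 i + N%:Z)%R| < N.*2.+1)%N.
  rewrite ltnS -addnn -lez_nat xE PoszD lerD2r.
  by have /andP[] := xN i.
exists [ffun i => Ordinal (bnd i)] => //.
by apply/rowP => i; rewrite mxE ffunE /= xE addrK.
Qed.

Definition box_ocell N (t : {ffun 'I_4 -> 'I_N.*2.+1} * {set 'I_4} * bool) :
  ocell := (box_point t.1.1, t.1.2, t.2).

(* The oriented [k]-cells with all corners in [box N]; the corner indexed by
   [set0] is the base point, so nothing is lost by starting from the cells
   based in the box. *)
Definition cells (N k : nat) : {fset ocell} :=
  [fset c in [fset box_ocell t |
               t in {: {ffun 'I_4 -> 'I_N.*2.+1} * {set 'I_4} * bool}] |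
     (cell_dim c.1 == k) &&
     [forall (I : {set 'I_4} | I \subset c.1.2), corner c.1 I \in box N]]%fset.

Lemma in_cells N k (c : ocell) :
  (c \in cells N k) =
  (cell_dim c.1 == k) &&
  [forall (I : {set 'I_4} | I \subset c.1.2), corner c.1 I \in box N].
Proof.
rewrite !inE /=; apply: andb_idl => /andP[_ /forallP cN].
have : c.1.1 \in box N.
  have /implyP/(_ (finset.sub0set _)) := cN finset.set0.
  by rewrite /corner big_set0 addr0.
case/imfsetP => f _ cE; apply/imfsetP => /=.
by exists (f, c.1.2, c.2) => //; rewrite /box_ocell /= -cE; case: c {cN cE} => -[].
Qed.

(** * Cochains with values in Z_n *)

(* A cochain on the infinite lattice, of all degrees at once. *)
Definition cochain (n : nat) := ocell -> 'Z_n.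

Definition eval_chain n (w : cochain n) (q : chain) : 'Z_n :=
  \sum_(c <- dom q) w (c, false) *~ coeff c q.

Definition dcochain n (w : cochain n) : cochain n :=
  fun c => eval_chain w (boundary_ocell c).

Definition config (n N k : nat) := {ffun cells N k -> 'Z_n}.

(* Extension by [0] outside of [B_N]. *)
Definition extend n N k (w : config n N k) : cochain n :=
  fun c => if insub c is Some c' then w c' else 0.

(* Omega^k(B_N, Z_n) *)
Definition forms (n N k : nat) : {set config n N k} :=
  [set w | [forall c : cells N k,
              extend w (opp_ocell (val c)) == - extend w (val c)]].

(** * The lattice Higgs model *)

Section Model.
Variables (R : realType) (n : nat) (rho : 'Z_n -> R[i]).

Definition faithful_unitary_rep : Prop :=
  [/\ rho 0 = 1, {morph rho : g h / g + h >-> g * h},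
      forall g, `|rho g| = 1 & injective rho].

(* Both sums are real, as [c] and [-c] contribute complex conjugates;
   [complex.Re] only serves to obtain an element of [R]. *)
Definition gauge_action (N : nat) (sigma : cochain n) : R :=
  complex.Re (\sum_(p <- cells N 2) rho (dcochain sigma p)).

Definition higgs_action (N : nat) (sigma phi : cochain n) : R :=
  complex.Re (\sum_(e <- cells N 1) rho (sigma e - eval_chain phi (boundary_ocell e))).

(* Only [0 <= beta <= +oo] is meaningful; the value at [-oo] is irrelevant. *)
Definition gauge_weight (N : nat) (beta : \bar R) (sigma : cochain n) : R :=
  match beta with
  | b%:E%E => expR (b * gauge_action N sigma)
  | +oo%E => (all (fun p => dcochain sigma p == 0) (cells N 2))%:R
  | -oo%E => 0
  end.

Definition weight (N : nat) (beta : \bar R) (kappa : R)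
    (sigma phi : cochain n) : R :=
  gauge_weight N beta sigma * expR (kappa * higgs_action N sigma phi).

Definition partition_function (N : nat) (beta : \bar R) (kappa : R) : R :=
  \sum_(s in forms n N 1) \sum_(f in forms n N 0)
    weight N beta kappa (extend s) (extend f).

Definition finite_volume_expectation (N : nat) (beta : \bar R) (kappa : R)
    (F : cochain n -> cochain n -> R[i]) : R[i] :=
  (\sum_(s in forms n N 1) \sum_(f in forms n N 0)
     (weight N beta kappa (extend s) (extend f))%:C * F (extend s) (extend f))
  / (partition_function N beta kappa)%:C.

(* [R[i]^o] carries the topology of the complex modulus. For local [F] the
   limit exists; [limn] of a divergent sequence is an unspecified value. *)
Definition infinite_volume_expectation (beta : \bar R) (kappa : R)
    (F : cochain n -> cochain n -> R[i]) : R[i] :=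
  limn (fun N => finite_volume_expectation N beta kappa F : R[i]^o).

Definition is_path (gamma : chain) : Prop :=
  [/\ is_chain 1 gamma,
      forall c, coeff c gamma \in [:: -1; 0; 1] &
      boundary gamma = 0 \/
      exists x1 x2, boundary gamma =
        << cell_of_vertex x2 >> - << cell_of_vertex x1 >>].

Definition L (gamma : chain) (sigma phi : cochain n) : R[i] :=
  rho (eval_chain sigma gamma - eval_chain phi (boundary gamma)).

Definition varphi (r : R) (g : 'Z_n) : R := expR (r * complex.Re (rho g - rho 0)).

Definition alpha0 (r : R) : R := \sum_(g : 'Z_n | g != 0) varphi r g ^+ 2.

(* All terms are positive, so the default value [0] plays no role. *)
Definition alpha1 (r : R) : R :=
  \big[Num.max/0]_(g : 'Z_n | g != 0) varphi r g ^+ 2.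

Definition K4 (kappa : R) : R := 18 ^+ 2 * (2 + alpha0 kappa).

Definition K3 (kappa : R) : R :=
  18 ^- 3 * (1 - 18 ^+ 2 * (2 + alpha0 kappa) * alpha0 kappa)^-1.

End Model.

(* Main.v *)
Require Import Defs.
From HB Require Import structures.
From mathcomp Require Import all_boot all_order all_algebra.
From mathcomp Require Import finmap freeg.
From mathcomp Require Import complex.
From mathcomp Require Import all_classical all_reals all_analysis.
From mathcomp Require Import ring lra zify.

(** In unitary gauge the model is a measure on Z_n-valued 1-forms on the edges
    of the box, whose weight factors over sets of edges that share no
    plaquette.  Two such measures are compared by taking an independent pair
    and exchanging the two configurations on the connected clusters of the
    union of the supports that meet [gamma]: the contributions cancel unless,
    on one of these clusters, the two weights differ.  Summing over clusters
    costs [x = alpha0 kappa * (2 + alpha0 kappa)] per edge, and [x < 18^-2] is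
    far below the threshold for the cluster sum to be at most [2 x].
    - The box [N] and a larger box only differ on clusters that reach the
      boundary, so finite-volume expectations form a Cauchy sequence; this is
      how the infinite-volume limits are shown to exist.
    - [beta] and [+oo] only differ on clusters that carry a non-closed 1-form;
      away from the boundary its coboundary is non-zero on at least 6
      plaquettes, each of which costs a factor [alpha1 beta]. *)

Set Implicit Arguments.
Unset Strict Implicit.
Unset Printing Implicit Defensive.

Import Order.TTheory GRing.Theory Num.Theory.
Import numFieldNormedType.Exports.

Local Open Scope ring_scope.
Local Open Scope complex_scope.

(** * Sums over connected sets of edges *)

Lemma ler_sum_dom (R : numDomainType) (I : finType) (P Q : pred I) (F G : I -> R) :
  (forall i, P i -> Q i /\ F i <= G i) -> (forall i, 0 <= G i) ->
  \sum_(i | P i) F i <= \sum_(i | Q i) G i.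
Proof.
move=> PQ G0; rewrite big_mkcond [leRHS]big_mkcond; apply: ler_sum => i _.
by case: ifP => [/PQ[->]|_]; last case: ifP.
Qed.

Section Animals.
Variables (E : finType) (adj : rel E).

Definition within (C : {set E}) : rel E :=
  [rel a b | [&& a \in C, b \in C & adj a b]].

Definition rooted (rs : seq E) (C : {set E}) : bool :=
  [forall a in C, has (fun r => (r \in C) && connect (within C) r a) rs].

Lemma rootedP (rs : seq E) (C : {set E}) :
  reflect (forall a, a \in C ->
             exists2 r, r \in rs & r \in C /\ connect (within C) r a)
          (rooted rs C).
Proof.
apply: (iffP forall_inP) => CP a /CP.
  by case/hasP => r rs_r /andP[]; exists r.
by case=> r rs_r [rC ra]; apply/hasP; exists r; rewrite ?rC.
Qed.

Lemma rooted_notin (r : E) (rs : seq E) (C : {set E}) :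
  r \notin C -> rooted (r :: rs) C = rooted rs C.
Proof. by move=> /negPf rC; apply: eq_forallb_in => a _ /=; rewrite rC. Qed.

(* Cut the path from a root of [C] to [a] at its last visit of [r]. *)
Lemma rooted_remove (r : E) (rs : seq E) (C : {set E}) :
  rooted (r :: rs) C -> rooted (enum (adj r) ++ rs) (C :\ r).
Proof.
move/rootedP => CP; apply/rootedP => a /setD1P[ar /CP[s s_rs [sC /connectP[p]]]].
case/shortenP => {}p sp up _ ap.
have stay b q : b != r -> r \notin q -> b \in C -> path (within C) b q ->
    path (within (C :\ r)) b q.
  elim: q b => //= c q IH b br; rewrite in_cons negb_or => /andP[rc rq] bC.
  case/andP=> /and3P[_ cC bc] cq; rewrite /within /= in_setD1 br bC in_setD1 eq_sym rc cC bc /=.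
  by apply: IH; rewrite // eq_sym.
have [sr|sr] := eqVneq s r.
  case: p => [|b q] in sp up ap *; first by rewrite ap sr eqxx in ar.
  move: sp up => /= /andP[/and3P[_ bC sb] bq] /andP[]; rewrite in_cons negb_or.
  case/andP=> sb' sq _; exists b; first by rewrite mem_cat mem_enum unfold_in -sr sb.
  rewrite in_setD1 -sr eq_sym sb' bC; split=> //; apply/connectP; exists q => //.
  by rewrite sr; apply: stay => //; rewrite -sr // eq_sym.
have [rp|rp] := boolP (r \in p); last first.
  exists s; first by move: s_rs; rewrite inE (negPf sr) mem_cat /= => ->; rewrite orbT.
  by rewrite in_setD1 sr sC; split=> //; apply/connectP; exists p => //; apply: stay.
case/splitPr: rp => p1 p2 in sp up ap *.
rewrite last_cat /= in ap.
move: sp; rewrite cat_path /= => /and3P[_ _].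
case: p2 => [|b q] in up ap *; first by rewrite ap eqxx in ar.
move=> /= /andP[/and3P[_ bC rb] bq].
move: up; rewrite -cat_cons cat_uniq => /and3P[_ _]; rewrite cons_uniq in_cons negb_or.
case/andP=> /andP[rb' rq] _; exists b; first by rewrite mem_cat mem_enum unfold_in rb.
rewrite in_setD1 eq_sym rb' bC; split=> //; apply/connectP; exists q => //.
by apply: stay => //; rewrite eq_sym.
Qed.


(** Deleting [r] gives the factor [x]; the rest hangs on the neighbours of [r] and on the remaining
    roots. *)
Lemma rooted_remove_sum (R : numDomainType) (x : R) (r : E) (rs : seq E) (U : {set E}) :
  0 <= x ->
  \sum_(C : {set E} | [&& C \subset U, rooted (r :: rs) C & r \in C]) x ^+ #|C|
  <= x * \sum_(C : {set E} | (C \subset U :\ r) && rooted (enum (adj r) ++ rs) C)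
           x ^+ #|C|.
Proof.
move=> x0; rewrite (reindex_onto (fun C => r |: C) (fun C => C :\ r)); last first.
  by move=> C /and3P[_ _ rC]; rewrite finset.setD1K.
rewrite big_distrr /=; apply: ler_sum_dom => C; last by rewrite mulr_ge0 ?exprn_ge0.
case/andP=> /and3P[CU Cr _] /eqP CE; split.
  by rewrite -CE finset.setSD //= rooted_remove.
have rC : r \notin C by rewrite -CE setD11.
by rewrite cardsU1 rC exprS.
Qed.

(* Explore the roots one at a time: either the first root is not in [C], or it
   is and its neighbours become new roots. *)
Lemma rooted_sum (R : numDomainType) (x y : R) (d : nat) (U : {set E}) (rs : seq E) :
  (forall e, (#|adj e| <= d)%N) -> 0 <= x -> 0 <= y -> x * (1 + y) ^+ d <= y ->
  \sum_(C : {set E} | (C \subset U) && rooted rs C) x ^+ #|C|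
  <= (1 + y) ^+ size rs.
Proof.
move=> degP x0 y0 xy; have y1 : 1 <= 1 + y by rewrite lerDl.
(* The outer induction serves the removal of [r] from [U], which makes [U] smaller but may lengthen
   the list of roots; the inner one, on [rs], serves a root outside [U]. *)
have [k] := ubnP #|U|; elim: k U rs => // k IH U rs; rewrite ltnS => Uk.
elim: rs => [|r rs IHrs].
  rewrite (big_pred1 finset.set0) ?cards0 // => C; apply/andP/eqP => [[_ /rootedP CP]|->].
    by apply/setP=> a; rewrite inE; apply/negP => /CP[].
  by rewrite finset.sub0set; split=> //; apply/rootedP => a; rewrite inE.
have [rU|rU] := boolP (r \in U); last first.
  apply: le_trans (_ : (1 + y) ^+ size rs <= _); last by rewrite ler_weXn2l.
  apply: le_trans IHrs; apply: ler_sum_dom => C; last by rewrite exprn_ge0.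
  case/andP=> CU Cr; rewrite lexx CU; split=> //=.
  by rewrite -(@rooted_notin r) //; apply: contra rU; apply/fintype.subsetP.
have Ur : (#|U :\ r| < k)%N by move: Uk; rewrite (cardsD1 r) rU.
rewrite (bigID (fun C : {set E} => r \in C)) /= exprS mulrDl mul1r [leRHS]addrC lerD //.
  under eq_bigl => C do rewrite -andbA.
  apply: le_trans (rooted_remove_sum r rs U x0) _.
  (* At most [d] new roots appear, and [x * (1 + y) ^+ d <= y] absorbs them. Relative to
     [(1 + y) ^+ size rs], this branch costs [y] and the branch without [r] costs 1. *)
  apply: le_trans (_ : x * (1 + y) ^+ (d + size rs) <= _).
    apply: ler_wpM2l => //; apply: le_trans (IH _ _ Ur) _.
    by rewrite ler_weXn2l // size_cat leq_add2r -cardE.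
  by rewrite exprD mulrA ler_wpM2r // exprn_ge0 // (le_trans ler01).
apply: le_trans (IH (U :\ r) rs Ur); apply: ler_sum_dom => C; last by rewrite exprn_ge0.
case/andP=> /andP[CU Cr] rC; rewrite lexx subsetD1 CU rC; split=> //=.
by rewrite -(@rooted_notin r).
Qed.

(** With the single root [e] in [C], all of [C] is reachable from [e] inside [C]. As the empty set
    is excluded, the bound is [y] instead of [1 + y]. *)
Lemma rooted_sum1 (R : numDomainType) (x y : R) (d : nat) (e : E) :
  (forall e, (#|adj e| <= d)%N) -> 0 <= x -> 0 <= y -> x * (1 + y) ^+ d <= y ->
  \sum_(C : {set E} | (e \in C) && rooted [:: e] C) x ^+ #|C| <= y.
Proof.
move=> degP x0 y0 xy; apply: (le_trans _ xy).
rewrite (eq_bigl (fun C : {set E} => [&& C \subset [set: E]%SET, rooted [:: e] C & e \in C]));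
  last by move=> C; rewrite finset.subsetT andbC.
apply: le_trans (rooted_remove_sum e [::] [set: E]%SET x0) (ler_wpM2l x0 _).
apply: le_trans (rooted_sum _ _ degP x0 y0 _) _ => //.
by rewrite cats0 ler_weXn2l ?lerDl // -cardE.
Qed.

End Animals.

(** * Swapping clusters *)

Lemma ler_sum_inj (R : numDomainType) (I J : finType) (h : I -> J)
    (P : pred I) (Q : pred J) (F : I -> R) (G : J -> R) :
  injective h -> (forall i, P i -> Q (h i) /\ F i <= G (h i)) ->
  (forall j, 0 <= G j) ->
  \sum_(i | P i) F i <= \sum_(j | Q j) G j.
Proof.
move=> h_inj PQ G0; apply: le_trans (_ : \sum_(i | P i) G (h i) <= _).
  by apply: ler_sum => i /PQ[].
rewrite -(big_imset _ (in2W h_inj)) /=; apply: ler_sum_dom => // j.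
by case/imsetP => i /PQ[Qi _] ->.
Qed.

Section Swap.
Variables (E : finType) (V : finZmodType) (adj : rel E).
Hypothesis adj_sym : symmetric adj.

Definition conf := {ffun E -> V}.
Implicit Types (s t : conf * conf) (A : {set E}).

Definition restr A (s : conf) : conf := [ffun e => if e \in A then s e else 0].

Definition splice A (s t : conf) : conf := [ffun e => if e \in A then s e else t e].

Definition supp2 s : {set E} := [set e | (s.1 e, s.2 e) != (0, 0)].

(** As [connect] is reflexive, the cluster of an edge outside [supp2 s] is that edge alone, and both
    configurations vanish on it. *)
Definition cluster s e : {set E} := [set a | connect (within adj (supp2 s)) e a].

Definition hull (l : seq E) s : {set E} := \bigcup_(e <- l) cluster s e.

Definition swap (l : seq E) s : conf * conf :=
  (splice (hull l s) s.2 s.1, splice (hull l s) s.1 s.2).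

Definition separating s A :=
  forall a b, a \in A -> b \notin A -> a \in supp2 s -> b \in supp2 s -> ~~ adj a b.

Lemma in_hull l s a : reflect (exists2 e, e \in l & a \in cluster s e) (a \in hull l s).
Proof. by rewrite /hull finset.bigcup_seq; apply: bigcupP. Qed.

Lemma hull_sep l s : separating s (hull l s).
Proof.
move=> a b /in_hull[e el]; rewrite inE => ea bH aS bS.
apply: contra bH => ab; apply/in_hull; exists e => //; rewrite inE.
by apply: connect_trans ea (connect1 _); rewrite /within /= aS bS.
Qed.

Lemma cluster_hull l s e : e \in l -> cluster s e \subset hull l s.
Proof. by move=> el; apply/fintype.subsetP => a ae; apply/in_hull; exists e. Qed.

Lemma cluster_refl s e : e \in cluster s e.
Proof. by rewrite inE connect0. Qed.

Lemma cluster_sep s e : separating s (cluster s e).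
Proof. by have := @hull_sep [:: e] s; rewrite /hull big_seq1. Qed.

Lemma within_sym A : symmetric (within adj A).
Proof. by move=> a b; rewrite /within /= adj_sym andbCA. Qed.

Lemma cluster_meet s e b a :
  a \in cluster s e -> a \in cluster s b -> cluster s e = cluster s b.
Proof.
rewrite !inE => ea ba; have csym := sym_connect_sym (within_sym (supp2 s)).
apply/setP => c; rewrite !inE; apply: (same_connect csym).
by apply: connect_trans ea _; rewrite csym.
Qed.

(** Exchanging the two values at an edge does not change whether one of them is non-zero. Hence
    clusters and hull survive the swap, which is therefore an involution. *)
Lemma supp2_swap l s : supp2 (swap l s) = supp2 s.
Proof.
apply/setP => e; rewrite !inE !ffunE; case: ifP => // _.
by rewrite !xpair_eqE andbC.
Qed.

Lemma cluster_swap l s e : cluster (swap l s) e = cluster s e.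
Proof. by rewrite /cluster supp2_swap. Qed.

Lemma hull_swap l s : hull l (swap l s) = hull l s.
Proof. by apply: eq_bigr => e _; rewrite cluster_swap. Qed.

Lemma swapK l : involutive (swap l).
Proof.
case=> s t; rewrite /swap hull_swap /=.
by congr (_, _); apply/ffunP => e; rewrite !ffunE; case: ifP => // ->.
Qed.

Lemma restr_swap l s A : A \subset hull l s ->
  restr A (swap l s).1 = restr A s.2 /\ restr A (swap l s).2 = restr A s.1.
Proof.
by move=> /fintype.subsetP AH; split; apply/ffunP => e; rewrite !ffunE; case: ifP => // /AH ->.
Qed.

Lemma restrC_swap l s :
  restr (~: hull l s) (swap l s).1 = restr (~: hull l s) s.1 /\
  restr (~: hull l s) (swap l s).2 = restr (~: hull l s) s.2.
Proof. by split; apply/ffunP => e; rewrite !ffunE inE; case: ifP => // /negPf ->. Qed.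

Lemma restr_restr A (B : {set E}) (s : conf) : restr A (restr B s) = restr (A :&: B) s.
Proof. by apply/ffunP => e; rewrite !ffunE inE; case: ifP. Qed.

Lemma restrD A (s : conf) e : s e = restr A s e + restr (~: A) s e.
Proof. by rewrite !ffunE inE; case: ifP; rewrite /= ?addr0 ?add0r. Qed.

Definition factoring (R : numDomainType) (w : conf -> R) :=
  forall A (s : conf),
    (forall a b, a \in A -> b \notin A -> s a != 0 -> s b != 0 -> ~~ adj a b) ->
    w s = w (restr A s) * w (restr (~: A) s).

(** * Comparison of two factoring weights *)

Section Weights.
Variables (R : numFieldType) (w1 w2 : conf -> R).
Hypotheses (w1_ge0 : forall u, 0 <= w1 u) (w2_ge0 : forall u, 0 <= w2 u).
Hypotheses (w1_0 : w1 0 = 1) (w2_0 : w2 0 = 1).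
Hypotheses (w1_fact : factoring w1) (w2_fact : factoring w2).

Lemma restr_factor (w : conf -> R) (s : conf * conf) A : factoring w -> separating s A ->
  w s.1 = w (restr A s.1) * w (restr (~: A) s.1) /\
  w s.2 = w (restr A s.2) * w (restr (~: A) s.2).
Proof.
move=> fw sA; split; apply: fw => a b aA bA sa sb; apply: sA => //;
  by rewrite inE xpair_eqE negb_and ?sa ?sb ?orbT.
Qed.

(** When [t] is not bad, exchanging its two components preserves [w1 t.1 * w2 t.2]. *)
Definition bad t : bool := (w1 t.1 != w2 t.1) || (w1 t.2 != w2 t.2).

Definition restr2 A s : conf * conf := (restr A s.1, restr A s.2).

Lemma separating_restr s A (B : {set E}) : separating s A -> separating (restr2 B s) A.
Proof.
move=> sA a b aA bA; rewrite !inE !ffunE /= => sa sb; apply: sA => //;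
  rewrite inE; [move: sa | move: sb]; by case: ifP; rewrite ?eqxx.
Qed.

(** By induction on [l]: a new cluster either meets the hull built so far and is then contained in
    it, or is disjoint from it, and then both weights factor over the two. *)
Lemma bad_hull l s :
  (forall e, e \in l -> ~~ bad (restr2 (cluster s e) s)) -> ~~ bad (restr2 (hull l s) s).
Proof.
rewrite /hull; elim: l => [|e l IH] good.
  have r0 (u : conf) : restr (\bigcup_(e <- [::]) cluster s e) u = 0.
    by apply/ffunP => e; rewrite !ffunE big_nil inE.
  by rewrite /bad /= !r0 w1_0 w2_0 eqxx.
have {}IH : ~~ bad (restr2 (hull l s) s).
  by apply: IH => b bl; apply: good; rewrite inE bl orbT.
rewrite big_cons; have := good e (mem_head _ _); set C := cluster s e => goodC.
rewrite -/(hull l s); set H := hull l s in IH *.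
have [/existsP[a /andP[aC aH]]|] := boolP [exists a, (a \in C) && (a \in H)].
  suff -> : C :|: H = H by [].
  apply/finset.setUidPr; case/in_hull: aH => b bl ab.
  by rewrite /C (cluster_meet aC ab) cluster_hull.
rewrite negb_exists => /forallP CH.
have sepC := @separating_restr s C (C :|: H) (@cluster_sep s e).
have CC : C :&: (C :|: H) = C by apply/finset.setIidPl; rewrite finset.subsetUl.
have CCH : ~: C :&: (C :|: H) = H.
  apply/setP => a; rewrite finset.in_setI finset.in_setC finset.in_setU; have := CH a.
  by case: (a \in C); case: (a \in H).
rewrite /bad; have [-> ->] := restr_factor w1_fact sepC.
have [-> ->] := restr_factor w2_fact sepC.
rewrite /= !restr_restr -/C CC CCH.
move: goodC IH; rewrite /bad /= !negb_or !negbK => /andP[/eqP -> /eqP ->].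
by case/andP=> /eqP -> /eqP ->; rewrite !eqxx.
Qed.

Definition bad_near (l : seq E) s := has (fun e => bad (restr2 (cluster s e) s)) l.

Lemma bad_near_swap l s : bad_near l (swap l s) = bad_near l s.
Proof.
apply: eq_in_has => e el; rewrite cluster_swap /restr2.
have [-> ->] := restr_swap (@cluster_hull l s e el).
by rewrite /bad /= orbC.
Qed.

(** All weights factor into a part on the hull and a part off it. The part off the hull is untouched
    by the swap, and on the hull [w1] and [w2] agree on both components. *)
Lemma weight_swap l s : ~~ bad_near l s ->
  w1 (swap l s).1 * w2 (swap l s).2 = w1 s.1 * w2 s.2.
Proof.
move=> /hasPn/bad_hull; set H := hull l s; rewrite /bad /= negb_or !negbK.
case/andP=> /eqP e1 /eqP e2.
have sepH : separating s H by apply: hull_sep.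
have sepH' : separating (swap l s) H.
  by rewrite /H -hull_swap; apply: hull_sep.
have [-> _] := restr_factor w1_fact sepH.
have [_ ->] := restr_factor w2_fact sepH.
have [-> _] := restr_factor w1_fact sepH'.
have [_ ->] := restr_factor w2_fact sepH'.
have [-> ->] := @restr_swap l s H (subxx _).
have [-> ->] := @restrC_swap l s; rewrite -/H e1 e2.
by rewrite mulrACA [RHS]mulrACA; congr (_ * _); rewrite mulrC.
Qed.

Variables (l : seq E) (F : conf -> R).
Hypothesis F_le1 : forall u, `|F u| <= 1.
Hypothesis F_loc : forall s t : conf, {in l, s =1 t} -> F s = F t.

Lemma F_swap s : F (swap l s).1 = F s.2 /\ F (swap l s).2 = F s.1.
Proof.
split; apply: F_loc => e el; rewrite ffunE;
  by have /fintype.subsetP -> := @cluster_hull l s e el; rewrite ?cluster_refl.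
Qed.

(** The swap maps the pairs without a bad cluster near [l] to themselves, keeps their weight and
    changes the sign of [F s.1 - F s.2], so their contribution equals its own negative. For the
    other pairs this difference is at most 2. *)
Lemma swap_bound :
  `|\sum_s w1 s.1 * w2 s.2 * (F s.1 - F s.2)|
  <= 2 * \sum_(s | bad_near l s) w1 s.1 * w2 s.2.
Proof.
rewrite (bigID (bad_near l)) /= [X in _ + X](_ : _ = 0) ?addr0; last first.
  set S := (X in X = 0); suff : S == - S by rewrite -addr_eq0 -mulr2n mulrn_eq0 => /eqP.
  rewrite /S {1}(reindex_inj (inv_inj (@swapK l))) /= -sumrN; apply/eqP.
  rewrite (eq_bigl (fun s => ~~ bad_near l s)); last first.
    by move=> s; rewrite /= bad_near_swap.
  apply: eq_bigr => s good; have [-> ->] := F_swap s.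
  by rewrite weight_swap // -mulrN opprB.
apply: le_trans (ler_norm_sum _ _ _) _; rewrite big_distrr /=; apply: ler_sum => s _.
rewrite normrM (ger0_norm (mulr_ge0 (w1_ge0 _) (w2_ge0 _))) mulrC ler_wpM2r ?mulr_ge0 //.
by rewrite (le_trans (ler_normB _ _)) // [2]mulr2n lerD.
Qed.

(** A path that starts at [e] and runs in [supp2 s] visits only edges of the cluster, so the cluster
    is connected by paths inside itself. *)
Lemma cluster_rooted s e : e \in supp2 s -> rooted adj [:: e] (cluster s e).
Proof.
move=> eS; apply/rootedP => a aC; exists e; rewrite ?mem_head // cluster_refl; split=> //.
move: (aC); rewrite inE => /connectP[p ep ap]; apply/connectP; exists p => //.
have : e \in cluster s e by apply: cluster_refl.
move: ep {aC ap}; rewrite /cluster; set C := [set _ | _]; move: {1 2 3}e.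
elim: p => //= b p IH x /andP[xb bp] xC.
have bC : b \in C by move: xC; rewrite /C !inE => xC; apply: connect_trans xC (connect1 xb).
by rewrite IH // /within /= xC bC /=; move: xb => /and3P[_ _ ->].
Qed.

(** A pair is determined by its restrictions to the cluster of [e] and to the complement, and its
    weight is the product of theirs. Letting the outer restriction range over all pairs yields the
    two partition functions. *)
Lemma bad_cluster_bound e :
  \sum_(s | bad (restr2 (cluster s e) s)) w1 s.1 * w2 s.2
  <= (\sum_(t | [&& bad t, e \in supp2 t & rooted adj [:: e] (supp2 t)]) w1 t.1 * w2 t.2)
     * ((\sum_u w1 u) * (\sum_u w2 u)).
Proof.
rewrite [(\sum_u w1 u) * _]big_distrlr /= pair_bigA /= big_distrlr /= pair_big /=.
pose h s := (restr2 (cluster s e) s, restr2 (~: cluster s e) s).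
apply: (@ler_sum_inj R _ _ h).
- move=> s t [e11 e12 e21 e22]; have cst a : s.1 a = t.1 a /\ s.2 a = t.2 a.
    rewrite (restrD (cluster s e) s.1) (restrD (cluster s e) s.2).
    by rewrite e11 e12 e21 e22 -!restrD.
  by case: s t cst {e11 e12 e21 e22} => [s1 s2] [t1 t2] /= st; congr (_, _);
    apply/ffunP => a; have [] := st a.
- move=> s bs; have [-> _] := restr_factor w1_fact (@cluster_sep s e).
  have [_ ->] := restr_factor w2_fact (@cluster_sep s e).
  rewrite /= [leRHS]mulrACA lexx bs; split=> //.
  have suppE : supp2 (restr2 (cluster s e) s) = cluster s e :&: supp2 s.
    by apply/setP => a; rewrite !inE !ffunE !inE; case: ifP => //; rewrite eqxx.
  have eS : e \in supp2 s.
    (* If [e] is not in the support, its cluster is [e] alone and both restrictions are 0, where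
       both weights equal 1; such a cluster is not bad. *)
    apply: contraTT bs => eS.
    suff r0 : restr (cluster s e) s.1 = 0 /\ restr (cluster s e) s.2 = 0.
      by rewrite /bad /= !r0.1 !r0.2 w1_0 w2_0 eqxx.
    have CE a : a \in cluster s e -> a = e.
      rewrite inE => /connectP[[|b p] //= /andP[/and3P[eS' _ _] _]].
      by rewrite eS' in eS.
    move: eS; rewrite inE negbK => /eqP[s1 s2].
    by split; apply/ffunP => a; rewrite !ffunE; case: ifP => // /CE ->.
  have -> : supp2 (restr2 (cluster s e) s) = cluster s e.
    rewrite suppE; apply/finset.setIidPl/fintype.subsetP => a; rewrite inE => /connectP[p].
    case/lastP: p => [_ -> //|p b]; rewrite rcons_path last_rcons => /andP[_ /and3P[_ bS _]].
    by move=> ->.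
  by rewrite cluster_refl cluster_rooted.
- by move=> [t u]; rewrite !mulr_ge0.
Qed.

(* The two expectations are compared by swapping the configurations on the
   clusters that meet [l], which exchanges [F s.1] and [F s.2]. *)
Lemma disagreement :
  `|(\sum_u w1 u * F u) / (\sum_u w1 u) - (\sum_u w2 u * F u) / (\sum_u w2 u)|
  <= 2 * \sum_(e <- l)
      \sum_(t | [&& bad t, e \in supp2 t & rooted adj [:: e] (supp2 t)]) w1 t.1 * w2 t.2.
Proof.
have Zgt0 (w : conf -> R) : (forall u, 0 <= w u) -> w 0 = 1 -> 0 < \sum_u w u.
  move=> w0 w1'; rewrite (bigD1 (0 : conf)) //= w1' ltr_wpDr ?ltr01 //.
  by rewrite sumr_ge0.
have Z1 := Zgt0 _ w1_ge0 w1_0; have Z2 := Zgt0 _ w2_ge0 w2_0.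
set z1 := (\sum_u w1 u) in Z1 *; set z2 := (\sum_u w2 u) in Z2 *.
(* The difference of the expectations is one expectation under the product of the two measures. *)
have -> : (\sum_u w1 u * F u) / z1 - (\sum_u w2 u * F u) / z2 =
    (\sum_s w1 s.1 * w2 s.2 * (F s.1 - F s.2)) / (z1 * z2).
  have -> : \sum_s w1 s.1 * w2 s.2 * (F s.1 - F s.2) =
      (\sum_u w1 u * F u) * z2 - z1 * (\sum_u w2 u * F u).
    rewrite !big_distrlr /= !pair_bigA /= -sumrB; apply: eq_bigr => s _.
    by rewrite mulrBr mulrAC -[w1 _ * w2 _ * F _]mulrA.
  rewrite mulrBl -mulf_div divff ?mulr1 ?gt_eqF //.
  by rewrite [z1 * _]mulrC [z1 * z2]mulrC -mulf_div divff ?mulr1 ?gt_eqF.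
have zz : 0 < z1 * z2 by rewrite mulr_gt0.
rewrite normrM normfV (gtr0_norm zz) ler_pdivrMr // -mulrA.
apply: le_trans swap_bound _; rewrite ler_wpM2l // big_distrl /=.
(* Union bound over the edges of [l]. *)
apply: le_trans (_ : \sum_(e <- l) \sum_(s | bad (restr2 (cluster s e) s)) w1 s.1 * w2 s.2 <= _);
  last by apply: ler_sum => e _; apply: bad_cluster_bound.
rewrite (exchange_big_dep predT) //= big_mkcond /=; apply: ler_sum => s _.
rewrite /bad_near; case: ifP => [/hasP[e el be]|_]; last first.
  by rewrite sumr_ge0 // => e _; rewrite mulr_ge0.
by rewrite (big_rem e) //= be lerDl sumr_ge0 // => b _; rewrite mulr_ge0.
Qed.

End Weights.

(** A pair of functions is a function with values in pairs, so for a fixed support [C] the sum is a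
    product over edges: each edge of [C] ranges over the non-zero pairs, and the others contribute
    [f 0 * f 0 = 1]. *)
Lemma sum_supp2 (R : numDomainType) (f : V -> R) (P : pred {set E}) : f 0 = 1 ->
  \sum_(s : conf * conf | P (supp2 s)) \prod_e (f (s.1 e) * f (s.2 e)) =
  \sum_(C : {set E} | P C) (\sum_(v : V * V | v != (0, 0)) f v.1 * f v.2) ^+ #|C|.
Proof.
move=> f0; rewrite (partition_big supp2 P) //=; apply: eq_bigr => C PC.
rewrite -prodr_const (big_distr_big (0, 0)) /=.
pose h (u : {ffun E -> V * V}) : conf * conf := ([ffun e => (u e).1], [ffun e => (u e).2]).
pose h' (s : conf * conf) : {ffun E -> V * V} := [ffun e => (s.1 e, s.2 e)].
rewrite (reindex h); last first.
  exists h' => [u _|[s t] _]; first by apply/ffunP => e; rewrite !ffunE -surjective_pairing.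
  by congr (_, _); apply/ffunP => e; rewrite !ffunE.
have suppE u : supp2 (h u) = [set e | u e != (0, 0)].
  by apply/setP => e; rewrite !inE !ffunE /= -surjective_pairing.
apply: eq_big => [u|u /andP[_ /eqP <-]].
  rewrite suppE; apply/andP/pffun_onP => [[_ /eqP <-]|[sub im]].
    split; first by apply/fintype.subsetP => e; rewrite !inE.
    by move=> v /fintype.imageP[e eu ->]; move: eu; rewrite !inE.
  suff -> : [set e | u e != (0, 0)] = C by rewrite PC eqxx.
  apply/setP => e; rewrite inE; apply/idP/idP => [ue|eC].
    by move/fintype.subsetP: sub; apply; rewrite inE.
  by apply: im; apply: fintype.image_f.
rewrite [LHS](bigID [in supp2 (h u)]) /= [X in _ * X]big1 ?mulr1.
  by apply: eq_bigr => e _; rewrite !ffunE.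
by move=> e; rewrite inE negbK => /eqP[-> ->]; rewrite f0 mulr1.
Qed.

End Swap.

(** * Chains and coboundaries *)

Section Chains.
Variable n : nat.
Implicit Types (w : cochain n) (q : chain).

(** Coefficients may cancel in a sum of chains and shrink its support; linearity is proved by
    summing over a common larger list. *)
Lemma eval_chainE w q (X : seq cell) : uniq X -> {subset dom q <= X} ->
  eval_chain w q = \sum_(c <- X) w (c, false) *~ coeff c q.
Proof.
move=> uX qX; rewrite /eval_chain [RHS](bigID [in dom q]) /= [X in _ + X]big1 ?addr0.
  rewrite -[RHS]big_filter; apply: perm_big; apply: uniq_perm.
  - exact: uniq_dom.
  - exact: filter_uniq.
  by move=> c; rewrite mem_filter andb_idr // => /qX.
by move=> c /coeff_outdom ->; rewrite mulr0z.
Qed.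

Lemma eval_chainD w : {morph eval_chain w : q r / q + r}.
Proof.
move=> q r; pose X := undup (dom q ++ dom r).
rewrite !(@eval_chainE w _ X) ?undup_uniq // => [| c | c | c].
- by rewrite -big_split; apply: eq_bigr => c _; rewrite coeffD mulrzDr.
- by rewrite mem_undup mem_cat => ->; rewrite orbT.
- by rewrite mem_undup mem_cat => ->.
- by move/domD_subset; rewrite mem_undup.
Qed.

Lemma eval_chain0 w : eval_chain w 0 = 0.
Proof. by rewrite /eval_chain dom0 big_nil. Qed.

Lemma eval_chainN w : {morph eval_chain w : q / - q}.
Proof. by move=> q; apply/eqP; rewrite -addr_eq0 -eval_chainD addNr eval_chain0. Qed.

Lemma eval_chainMz w q (m : int) : eval_chain w (m *: q) = eval_chain w q *~ m.
Proof.
rewrite (@eval_chainE w (m *: q) (dom q)) ?uniq_dom //.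
  rewrite /eval_chain mulrz_suml; apply: eq_bigr => c _.
  by rewrite coeffZ mulrC mulrzA.
by move=> c; rewrite !mem_dom coeffZ; apply: contraNneq => ->; rewrite mulr0.
Qed.

Lemma eval_chain_sum w (I : Type) (r : seq I) (P : pred I) (F : I -> chain) :
  eval_chain w (\sum_(i <- r | P i) F i) = \sum_(i <- r | P i) eval_chain w (F i).
Proof. exact: (big_morph _ (@eval_chainD w) (eval_chain0 w)). Qed.

Lemma eval_chainU w c : eval_chain w << c >> = w (c, false).
Proof. by rewrite /eval_chain domU1 big_seq1 coeffU eqxx mulr1. Qed.

Definition cob_sign (J : {set 'I_4}) (j : 'I_4) : int :=
  (-1) ^+ #|[set i in J | (i < j)%N]|.

(** Stated for functions on positively oriented cells, so that it can be iterated and applied to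
    gauge-transformed fields without an antisymmetry condition. *)
Definition coboundary (u : cell -> 'Z_n) (c : cell) : 'Z_n :=
  \sum_(j in c.2) (u (c.1 + unit_vec j, (c.2 :\ j)%SET) - u (c.1, (c.2 :\ j)%SET))
     *~ cob_sign c.2 j.

Definition pos w : cell -> 'Z_n := fun c => w (c, false).

Lemma eval_boundary_cell w c : eval_chain w (boundary_cell c) = coboundary (pos w) c.
Proof.
rewrite eval_chain_sum; apply: eq_bigr => j _.
by rewrite eval_chainMz eval_chainD eval_chainN !eval_chainU.
Qed.

Lemma dcochainE w c b : dcochain w (c, b) = coboundary (pos w) c *~ (-1) ^+ b.
Proof. by rewrite /dcochain eval_chainMz eval_boundary_cell. Qed.

Lemma eval_boundary w q :
  eval_chain w (boundary q) = \sum_(c <- dom q) coboundary (pos w) c *~ coeff c q.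
Proof.
by rewrite eval_chain_sum; apply: eq_bigr => c _; rewrite eval_chainMz eval_boundary_cell.
Qed.

Definition faces (c : cell) : seq cell :=
  [seq (c.1 + unit_vec j, (c.2 :\ j)%SET) | j <- enum c.2]
  ++ [seq (c.1, (c.2 :\ j)%SET) | j <- enum c.2].

Lemma mem_faces (c f : cell) : reflect (exists j (b : bool), j \in c.2 /\ 
    f = (c.1 + (if b then unit_vec j else 0), (c.2 :\ j)%SET)) (f \in faces c).
Proof.
rewrite mem_cat; apply: (iffP orP) => [[/mapP[j]|/mapP[j]]|[j [b [jc ->]]]].
- by rewrite mem_enum => jc ->; exists j, true.
- by rewrite mem_enum => jc ->; exists j, false; rewrite addr0.
by case: b; [left|right; rewrite addr0]; apply/mapP; exists j; rewrite ?mem_enum.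
Qed.

Lemma eq_coboundary (u v : cell -> 'Z_n) c :
  {in faces c, u =1 v} -> coboundary u c = coboundary v c.
Proof.
move=> uv; apply: eq_bigr => j jc; rewrite !uv //; apply/mem_faces.
  by exists j, false; rewrite addr0.
by exists j, true.
Qed.

Lemma coboundary0 c : coboundary (fun=> 0) c = 0.
Proof. by apply: big1 => j _; rewrite subr0 mul0rz. Qed.

Lemma coboundaryD (u v : cell -> 'Z_n) c :
  coboundary (fun a => u a + v a) c = coboundary u c + coboundary v c.
Proof. by rewrite -big_split; apply: eq_bigr => j _ /=; rewrite -mulrzDl opprD addrACA. Qed.

Lemma coboundaryN (u : cell -> 'Z_n) c : coboundary (fun a => - u a) c = - coboundary u c.
Proof. by rewrite -sumrN; apply: eq_bigr => j _; rewrite -mulNrz opprB opprK addrC. Qed.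

(** Removing the smaller index [i] lowers the position of [j] by one, while removing [j] leaves the
    position of [i] unchanged. *)
Lemma cob_sign_swap (K : {set 'I_4}) (i j : 'I_4) : (i < j)%N -> i \in K -> j \in K ->
  cob_sign K i * cob_sign (K :\ i) j = - (cob_sign K j * cob_sign (K :\ j) i).
Proof.
move=> ij iK jK; rewrite /cob_sign.
have -> : [set a in (K :\ j)%SET | (a < i)%N] = [set a in K | (a < i)%N].
  apply/setP => a; rewrite !inE; case: eqP => // ->.
  by rewrite [(j < i)%N]ltnNge (ltnW ij) !andbF.
rewrite [#|[set a in K | (a < j)%N]|](cardsD1 i) inE iK ij add1n.
have -> : [set a in (K :\ i)%SET | (a < j)%N] = [set a in K | (a < j)%N] :\ i.
  by apply/setP => a; rewrite !inE andbA.
by rewrite exprS mulN1r mulNr opprK mulrC.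
Qed.

(** The second difference [T i j] is symmetric and its sign is antisymmetric in [i] and [j], so the
    terms with [i < j] cancel those with [j < i]. *)
Lemma coboundaryK (u : cell -> 'Z_n) c : coboundary (coboundary u) c = 0.
Proof.
case: c => x K; rewrite /coboundary /=.
pose T i j : 'Z_n :=
  (u (x + unit_vec i + unit_vec j, (K :\ i :\ j)%SET) - u (x + unit_vec i, (K :\ i :\ j)%SET)
   - (u (x + unit_vec j, (K :\ i :\ j)%SET) - u (x, (K :\ i :\ j)%SET))).
have Tsym i j : T i j = T j i.
  rewrite /T (_ : (K :\ i :\ j)%SET = (K :\ j :\ i)%SET); last first.
    by apply/setP => a; rewrite !inE andbCA.
  by rewrite [x + _ + _]addrAC !opprB !addrA [LHS]addrAC [RHS]addrAC; congr (_ + _); rewrite [LHS]addrAC.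
transitivity (\sum_(i in K) \sum_(j in K | i != j) T i j *~ (cob_sign K i * cob_sign (K :\ i) j)).
  apply: eq_bigr => i iK; rewrite -sumrB mulrz_suml; apply: eq_big => [j|j].
    by rewrite !inE andbC eq_sym.
  by rewrite -mulrzBl -mulrzA mulrC.
rewrite pair_big_dep /= (bigID (fun p : 'I_4 * 'I_4 => (p.1 < p.2)%N)) /=.
rewrite [X in _ + X](_ : _ =
  \sum_(p : 'I_4 * 'I_4 | [&& p.1 \in K, p.2 \in K & p.1 != p.2] && (p.1 < p.2)%N)
     - (T p.1 p.2 *~ (cob_sign K p.1 * cob_sign (K :\ p.1) p.2))).
  by rewrite sumrN subrr.
have swapK : involutive (fun p : 'I_4 * 'I_4 => (p.2, p.1)) by case.
rewrite (reindex_inj (inv_inj swapK)) /=.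
apply: eq_big => [[i j]|[i j]] /=.
  rewrite andbCA [j == i]eq_sym -leqNgt; case: (ltngtP i j) => //; rewrite ?andbF //.
  by move/val_inj ->; rewrite eqxx !andbF.
case/andP=> /and3P[jK iK ji]; rewrite -leqNgt leq_eqVlt => /orP[/eqP/val_inj ij|ij].
  by rewrite ij eqxx in ji.
by rewrite Tsym -mulrNz cob_sign_swap // opprK.
Qed.

End Chains.

(** * Weights of the lattice Higgs model *)

Definition pcells (N k : nat) : {fset cell} := [fset c.1 | c in cells N k]%fset.

Lemma mem_pcells N k (c : cell) :
  (c \in pcells N k) = (cell_dim c == k) &&
  [forall (I : {set 'I_4} | I \subset c.2), corner c I \in box N].
Proof.
apply/imfsetP/idP => [[p + ->]|cN]; first by rewrite in_cells.
by exists (c, false); rewrite // in_cells.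
Qed.

Lemma in_cells_pcells N k (p : ocell) : (p \in cells N k) = (p.1 \in pcells N k).
Proof. by rewrite in_cells mem_pcells. Qed.

Lemma big_cells (T : Type) (idx : T) (op : Monoid.com_law idx) N k (G : ocell -> T) :
  \big[op/idx]_(p <- cells N k) G p =
  \big[op/idx]_(c <- pcells N k) op (G (c, false)) (G (c, true)).
Proof.
rewrite big_split /= -(big_map (fun c => (c, false)) predT G).
rewrite -[X in op _ X](big_map (fun c => (c, true)) predT G) -big_cat /=.
have mem_b (s : seq cell) c (b b' : bool) :
    ((c, b) \in [seq (x, b') | x <- s]) = (b == b') && (c \in s).
  apply/mapP/andP => [[x xs [-> ->]]|[/eqP -> cs]]; first by rewrite eqxx.
  by exists c.
apply: perm_big; apply: uniq_perm; first exact: fset_uniq.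
  rewrite cat_uniq !map_inj_uniq ?fset_uniq //= ?andbT; try by move=> x y [].
  by apply/hasPn => _ /mapP[c _ ->] /=; rewrite mem_b.
by case=> c b; rewrite in_cells_pcells mem_cat !mem_b /=; case: b; rewrite ?orbF.
Qed.

Lemma corner_sub (c : cell) j (b : bool) (I : {set 'I_4}) : j \in c.2 -> I \subset (c.2 :\ j)%SET ->
  exists2 J : {set 'I_4}, J \subset c.2 &
    corner (c.1 + (if b then unit_vec j else 0), (c.2 :\ j)%SET) I = corner c J.
Proof.
rewrite subsetD1 => jc /andP[Ic jI]; case: b.
  exists (j |: I); first by rewrite finset.subUset finset.sub1set jc.
  by rewrite /corner /= big_setU1 //= addrA.
by exists I => //; rewrite /corner addr0.
Qed.

Lemma faces_pcells N k p : p \in pcells N k.+1 -> {subset faces p <= pcells N k}.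
Proof.
rewrite !mem_pcells => /andP[/eqP dp /forall_inP pN] _ /mem_faces[j [b [jp ->]]].
rewrite mem_pcells; apply/andP; split.
  by apply/eqP; move: dp; rewrite /cell_dim /= (cardsD1 j) jp add1n => -[].
by apply/forall_inP => I /(corner_sub b jp)[J Jp ->]; apply: pN.
Qed.

Section Model.
Variables (R : realType) (n : nat) (rho : 'Z_n -> R[i]).
Hypothesis rho_rep : faithful_unitary_rep rho.

(** Since [rho g] has modulus 1, its inverse [rho (- g)] is its conjugate. *)
Lemma Re_rhoN g : complex.Re (rho (- g)) = complex.Re (rho g).
Proof.
case: rho_rep => r0 rD r1 _.
have -> : rho (- g) = (rho g)^*.
  have g1 : rho g * rho (- g) = 1 by rewrite -rD subrr.
  have gu : rho g != 0 by rewrite -normr_eq0 r1 oner_eq0.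
  by apply: (mulfI gu); rewrite g1 -sqr_normc r1 expr1n.
by case: (rho g).
Qed.

Lemma Re_rho_le1 g : complex.Re (rho g) <= 1.
Proof.
case: rho_rep => _ _ r1 _; rewrite -lecR; apply: (@le_trans _ _ `|rho g|).
  by apply: le_trans (normc_ge_Re _); rewrite lecR ler_norm.
by rewrite r1 rmorph1.
Qed.

Lemma Re_sum (I : Type) (r : seq I) (P : pred I) (F : I -> R[i]) :
  complex.Re (\sum_(i <- r | P i) F i) = \sum_(i <- r | P i) complex.Re (F i).
Proof. by apply: (big_morph (@complex.Re R)) => // -[a b] [c d]. Qed.

Definition plaquette_factor (beta : \bar R) (g : 'Z_n) : R :=
  match beta with
  | b%:E%E => varphi rho b g
  | _ => (g == 0)%:R
  end.

Lemma varphiN r g : varphi rho r (- g) = varphi rho r g.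
Proof.
rewrite /varphi; congr (expR (r * _)).
by have := Re_rhoN g; case: (rho (-g)) => a b; case: (rho g) => c d /= ->; case: (rho 0).
Qed.

Lemma plaquette_factorN beta g : plaquette_factor beta (- g) = plaquette_factor beta g.
Proof. by case: beta => [r||] /=; rewrite ?varphiN ?oppr_eq0. Qed.

Lemma varphiE r g : varphi rho r g = expR (r * complex.Re (rho g)) * expR (- r).
Proof.
rewrite /varphi -expRD; case: rho_rep => -> _ _ _; congr expR.
by case: (rho g) => a b /=; rewrite mulrBr mulr1.
Qed.

Lemma varphi_prod r (I : Type) (s : seq I) (F : I -> 'Z_n) :
  expR (r * complex.Re (\sum_(i <- s) rho (F i))) =
  expR r ^+ size s * \prod_(i <- s) varphi rho r (F i).
Proof.
rewrite Re_sum; elim: s => [|i s IH]; first by rewrite !big_nil mulr0 expR0 mulr1.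
rewrite !big_cons mulrDr expRD IH varphiE /= exprS.
have e0 : expR r != 0 by rewrite gt_eqF ?expR_gt0.
rewrite expRN; field.
by rewrite e0.
Qed.

(** The square collects the two orientations of a plaquette, whose factors agree. The constant [c]
    comes from normalising the factor to 1 at 0, and cancels in expectations. *)
Lemma gauge_weightE N beta : beta != -oo%E -> exists2 c : R, 0 < c &
  forall s : cochain n, gauge_weight rho N beta s =
   c * \prod_(p <- pcells N 2) plaquette_factor beta (coboundary (pos s) p) ^+ 2.
Proof.
have pE b (s : cochain n) : \prod_(p <- cells N 2) plaquette_factor b (dcochain s p) =
    \prod_(p <- pcells N 2) plaquette_factor b (coboundary (pos s) p) ^+ 2.
  rewrite big_cells; apply: eq_bigr => p _ /=.
  by rewrite !dcochainE /= expr0 expr1 mulr1z mulrN1z plaquette_factorN expr2.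
case: beta => [b||] // _.
  exists (expR b ^+ size (cells N 2)) => [|s]; first by rewrite exprn_gt0 ?expR_gt0.
  by rewrite /gauge_weight /gauge_action varphi_prod -pE.
exists 1 => // s; rewrite mul1r -pE /= big_seq; case: allP => [s0|].
  by rewrite big1 // => p /s0 ->.
move=> /allP; rewrite -has_predC => /hasP[p pN /= /negPf p0].
by rewrite -big_seq (big_rem p) //= p0 mul0r.
Qed.

Lemma higgs_weightE N kappa : exists2 c : R, 0 < c &
  forall (s f : cochain n), (forall e, e \in pcells N 1 -> s (e, true) = - s (e, false)) ->
   expR (kappa * higgs_action rho N s f) =
   c * \prod_(e <- pcells N 1) varphi rho kappa (pos s e - coboundary (pos f) e) ^+ 2.
Proof.
exists (expR kappa ^+ size (cells N 1)) => [|s f sN].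
  by rewrite exprn_gt0 ?expR_gt0.
rewrite /higgs_action varphi_prod big_cells; congr (_ * _).
rewrite big_seq [RHS]big_seq; apply: eq_bigr => e eN /=.
rewrite sN // -!/(dcochain f (e, _)) !dcochainE expr0 expr1 mulr1z mulrN1z -opprD varphiN.
by rewrite expr2.
Qed.

End Model.

(** * Unitary gauge *)

Lemma in_box_le N M x : (N <= M)%N -> x \in box N -> x \in box M.
Proof.
move=> NM; rewrite !in_box => /forallP xN; apply/forallP => i.
by have := xN i; lia.
Qed.

Lemma pcells_le N M k : (N <= M)%N -> {subset pcells N k <= pcells M k}.
Proof.
move=> NM c; rewrite !mem_pcells => /andP[-> /forall_inP cN].
by apply/forall_inP => I /cN; apply: in_box_le.
Qed.

Section Reduction.
Variables (R : realType) (n : nat) (rho : 'Z_n -> R[i]).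
Hypothesis rho_rep : faithful_unitary_rep rho.

Definition pconf (M : nat) := conf (pcells M 1 : finType) 'Z_n.

Definition ext M (s : pconf M) : cell -> 'Z_n :=
  fun c => if insub c is Some e then s e else 0.

Lemma ext_val M (s : pconf M) (e : pcells M 1) : ext s (val e) = s e.
Proof. by rewrite /ext valK. Qed.

(* Edges of [pcells M 1] outside of the box [N] are forced to carry [0], so that
   all boxes inside [M] are measures on the same space [pconf M]. *)
Definition edge_factor N (kappa : R) (e : cell) (g : 'Z_n) : R :=
  if e \in pcells N 1 then varphi rho kappa g ^+ 2 else (g == 0)%:R.

Definition box_weight N beta kappa M (s : pconf M) : R :=
  (\prod_(e : pcells M 1) edge_factor N kappa (val e) (s e)) *
  \prod_(p <- pcells N 2) plaquette_factor rho beta (coboundary (ext s) p) ^+ 2.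

Definition supported N M (s : pconf M) : bool :=
  [forall e : pcells M 1, (val e \in pcells N 1) || (s e == 0)].

Lemma extend_val N k (w : config n N k) (c : cells N k) : extend w (val c) = w c.
Proof. by rewrite /extend valK. Qed.

Lemma forms_opp N k (w : config n N k) e : w \in forms n N k -> e \in pcells N k ->
  extend w (e, true) = - extend w (e, false).
Proof.
rewrite inE => /forallP wN eN.
have ec : (e, false) \in cells N k by rewrite in_cells_pcells.
exact/eqP/(wN [` ec]%fset).
Qed.

(** Translation by [d] is a bijection, so the right-hand side does not depend on [d]. With [d] the
    coboundary of a 0-form, this is the passage to unitary gauge. *)
Lemma sum_forms (T : nmodType) N M (d : cell -> 'Z_n) (G : (cell -> 'Z_n) -> T) :
  (N <= M)%N -> (forall u v, {in pcells N 1, u =1 v} -> G u = G v) ->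
  \sum_(s in forms n N 1) G (fun c => pos (extend s) c - d c) =
  \sum_(s : pconf M | supported N s) G (ext s).
Proof.
move=> NM Gloc.
pose h (s : pconf M) : config n N 1 :=
  [ffun c : cells N 1 => (ext s (val c).1 + d (val c).1) *~ (-1) ^+ (val c).2].
pose h' (s : config n N 1) : pconf M :=
  [ffun e : pcells M 1 =>
     if val e \in pcells N 1 then pos (extend s) (val e) - d (val e) else 0].
have extE s c b : c \in pcells N 1 -> extend (h s) (c, b) = (ext s c + d c) *~ (-1) ^+ b.
  move=> cN; have cc : (c, b) \in cells N 1 by rewrite in_cells_pcells.
  by rewrite (extend_val (h s) [` cc]%fset) ffunE.
have ext' s c : c \in pcells N 1 -> ext (h' s) c = pos (extend s) c - d c.
  move=> cN; have cM := pcells_le NM cN.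
  by rewrite (ext_val (h' s) [` cM]%fset) ffunE /= cN.
rewrite (reindex_onto h h') /=; last first.
  move=> s sf; apply/ffunP => c; rewrite ffunE; have := valP c.
  rewrite in_cells_pcells => cN; rewrite ext' // subrK -extend_val.
  case: (val c) cN => e b /= eN; case: b; rewrite ?mulr1z //.
  by rewrite expr1 mulrN1z forms_opp.
apply: eq_big => [s|s /andP[_ /eqP sE]].
  apply/andP/forallP => [[_ /eqP <-] e|sN].
    by rewrite ffunE; case: ifP => //= _.
  split.
    rewrite inE; apply/forallP => c; have := valP c; rewrite in_cells_pcells.
    case: (val c) => e b /= eN; rewrite /opp_ocell /= !extE //.
    by case: b; rewrite /= expr0 expr1 mulr1z mulrN1z ?opprK.
  apply/eqP/ffunP => e; rewrite ffunE; have := sN e.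
  case: ifP => [eN _|_ /= /eqP -> //].
  by rewrite /pos extE // expr0 mulr1z addrK ext_val.
by apply: Gloc => c cN; rewrite /pos extE // expr0 mulr1z addrK.
Qed.

Definition loop_value (gamma : chain) (u : cell -> 'Z_n) : R[i] :=
  rho (\sum_(c <- dom gamma) u c *~ coeff c gamma).

Lemma L_loop_value gamma s f :
  L rho gamma s f = loop_value gamma (fun c => pos s c - coboundary (pos f) c).
Proof.
rewrite /L /loop_value eval_boundary /eval_chain -sumrB; congr rho.
by apply: eq_bigr => c _; rewrite mulrzBl.
Qed.

Definition cell_weight N beta kappa (u : cell -> 'Z_n) : R :=
  (\prod_(e <- pcells N 1) varphi rho kappa (u e) ^+ 2) *
  \prod_(p <- pcells N 2) plaquette_factor rho beta (coboundary u p) ^+ 2.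

(** An edge outside the box [N] with a non-zero value annihilates the product through its indicator
    factor. *)
Lemma box_weightE N M beta kappa (s : pconf M) : (N <= M)%N ->
  box_weight N beta kappa s =
  if supported N s then cell_weight N beta kappa (ext s) else 0.
Proof.
move=> NM; rewrite /box_weight /cell_weight.
case: ifP => [/forallP sN|/negbT]; last first.
  rewrite negb_forall => /existsP[e]; rewrite negb_or => /andP[/negPf eN /negPf se].
  by rewrite (bigD1 e) //= /edge_factor eN se !mul0r.
congr (_ * _).
rewrite (bigID (fun e : pcells M 1 => val e \in pcells N 1)) /=.
rewrite [X in _ * X]big1 ?mulr1; last first.
  by move=> e /negPf eN; have := sN e; rewrite /edge_factor eN /= => /eqP ->; rewrite eqxx.
have -> : \prod_(e <- pcells N 1) varphi rho kappa (ext s e) ^+ 2 =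
    \prod_(e : pcells N 1) varphi rho kappa (ext s (val e)) ^+ 2.
  by rewrite big_seq_fsetE.
have imN (e : pcells N 1) : val e \in pcells M 1 by apply: pcells_le NM _ (valP e).
pose i (e : pcells N 1) : pcells M 1 := [` imN e]%fset.
pose i' (e : pcells M 1) : option (pcells N 1) := insub (val e).
rewrite (reindex_omap i i') /=; last first.
  move=> e eN; rewrite /i' insubT /=; congr Some; exact: val_inj.
apply: eq_big => e.
  rewrite (valP e) /=; apply/eqP; rewrite /i' /=; exact: valK.
by move=> _; rewrite /edge_factor (valP e) -ext_val.
Qed.

(** Weight and observable depend on [s] and [f] only through [s - d f], since [d (d f) = 0] in the
    plaquette term. For each [f] the sum over [s] is thus the same, and the number of 0-forms
    cancels in the quotient. *)
Lemma finite_volumeE N M beta kappa gamma : (N <= M)%N -> beta != -oo%E ->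
  {subset dom gamma <= pcells N 1} ->
  finite_volume_expectation rho N beta kappa (L rho gamma) =
  (\sum_(s : pconf M) (box_weight N beta kappa s)%:C * loop_value gamma (ext s)) /
  (\sum_(s : pconf M) box_weight N beta kappa s)%:C.
Proof.
move=> NM beta_fin gN.
have [c1 c1_gt0 gE] := gauge_weightE rho_rep N beta_fin.
have [c2 c2_gt0 hE] := higgs_weightE rho_rep N kappa.
have WE s (f : config n N 0) : s \in forms n N 1 -> weight rho N beta kappa (extend s) (extend f) =
    (c1 * c2) * cell_weight N beta kappa
      (fun c => pos (extend s) c - coboundary (pos (extend f)) c) :> R.
  move=> sf; rewrite /weight gE hE; last by move=> e eN; apply: forms_opp.
  rewrite mulrACA [X in _ * X]mulrC; congr (_ * (_ * _)); apply: eq_bigr => p _.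
  by rewrite coboundaryD coboundaryN coboundaryK oppr0 addr0.
have cwloc u v : {in pcells N 1, u =1 v} ->
    cell_weight N beta kappa u = cell_weight N beta kappa v.
  move=> uv; rewrite /cell_weight; congr (_ * _); rewrite big_seq [RHS]big_seq;
    apply: eq_bigr => p pN; first by rewrite uv.
  by rewrite (@eq_coboundary _ u v) // => e /(faces_pcells pN); apply: uv.
(* The morphism [Q] lets one identity serve the complex numerator, with the embedding of [R], and
   the real denominator, with the identity and [H = 1]. *)
have sumE (T : numFieldType) (Q : {rmorphism R -> T}) (H : (cell -> 'Z_n) -> T) :
    (forall u v, {in pcells N 1, u =1 v} -> H u = H v) ->
    \sum_(s in forms n N 1) \sum_(f in forms n N 0)
       Q (weight rho N beta kappa (extend s) (extend f)) *
       H (fun c => pos (extend s) c - coboundary (pos (extend f)) c) =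
    Q (c1 * c2) *+ #|forms n N 0| * \sum_(s : pconf M) Q (box_weight N beta kappa s) * H (ext s).
  move=> Hloc; rewrite exchange_big /=.
  under eq_bigr => f _.
    under eq_bigr => s sf do rewrite (WE s f sf) rmorphM -mulrA.
    rewrite -big_distrr /=.
    rewrite (@sum_forms _ _ M _ (fun u => Q (cell_weight N beta kappa u) * H u)) //; last first.
      by move=> u v uv; rewrite (cwloc _ _ uv) (Hloc _ _ uv).
    over.
  rewrite sumr_const mulrnAl; congr (_ * _ *+ _).
  rewrite big_mkcond; apply: eq_bigr => s _; rewrite box_weightE //.
  by case: ifP => // _; rewrite rmorph0 mul0r.
rewrite /finite_volume_expectation /partition_function.
under eq_bigr => s _ do under eq_bigr => f _ do rewrite L_loop_value.
rewrite (sumE _ (real_complex R)); last first.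
  move=> u v uv; rewrite /loop_value big_seq [in RHS]big_seq; congr rho.
  by apply: eq_bigr => c /gN /uv ->.
have -> : \sum_(s in forms n N 1) \sum_(f in forms n N 0)
      weight rho N beta kappa (extend s) (extend f) =
    c1 * c2 *+ #|forms n N 0| * \sum_(s : pconf M) box_weight N beta kappa s.
  transitivity (c1 * c2 *+ #|forms n N 0| * \sum_(s : pconf M) box_weight N beta kappa s * 1).
    rewrite -(sumE R idfun (fun=> 1)) //=.
    by apply: eq_bigr => s _; apply: eq_bigr => f _; rewrite mulr1.
  by congr (_ * _); apply: eq_bigr => s _; rewrite mulr1.
have k_gt0 : 0 < c1 * c2 by rewrite mulr_gt0.
move: (c1 * c2) k_gt0 => k k_gt0.
rewrite rmorphM rmorphMn /= -mulf_div divff ?mul1r //.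
have f0 : (0 < #|forms n N 0|)%N.
  apply/card_gt0P; exists [ffun=> 0]; rewrite inE; apply/forallP => e.
  have e0 a : extend [ffun=> 0 : 'Z_n] a = 0 :> 'Z_n.
    by rewrite /extend; case: insub => // b; rewrite ffunE.
  by rewrite !e0 oppr0.
by rewrite mulrn_eq0 negb_or -lt0n f0 /= gt_eqF // (ltcR 0).
Qed.

End Reduction.

(** * Six plaquettes *)

(* Twice the barycentre of the cell. *)
Definition center (c : cell) (i : 'I_4) : int := 2 * c.1 0 i + (i \in c.2)%:R.

Lemma unit_vecE j i : unit_vec j 0 i = (i == j)%:R.
Proof. by rewrite mxE eqxx eq_sym. Qed.

Lemma center_face (x : vertex) (J : {set 'I_4}) j (b : bool) i : j \in J ->
  center (x + (if b then unit_vec j else 0), (J :\ j)%SET) i =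
  center (x, J) i + (if b then 1 else -1) *+ (i == j).
Proof.
move=> jJ; rewrite /center /= !inE mxE.
have [->|ij] := eqVneq i j; rewrite /= ?jJ; case: b; rewrite ?mxE ?eqxx ?(negPf ij) ?andbF /=; try lia.
Qed.

Section SixPlaquettes.
Variables (n : nat) (w : cell -> 'Z_n).
Hypothesis w_closed : forall c, coboundary w c = 0.

Lemma mulz_sign_eq0 (x : 'Z_n) k : x *~ (-1) ^+ k = 0 -> x = 0.
Proof.
rewrite -signr_odd; case: (odd k); rewrite ?mulr1z // mulrN1z => /eqP.
by rewrite oppr_eq0 => /eqP.
Qed.

(** The signed sum of [w] over the faces of [c] vanishes, so it cannot have exactly one non-zero
    term. *)
Lemma second_face c f : f \in faces c -> w f != 0 ->
  exists2 g, g \in faces c & (g != f) && (w g != 0).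
Proof.
move=> fc wf; case: (boolP (has (fun g => (g != f) && (w g != 0)) (faces c))).
  by case/hasP => g gc gf; exists g.
move=> /hasPn none; have w0 g : g \in faces c -> g != f -> w g = 0.
  by move=> /none; rewrite negb_and => /orP[/negPn/eqP -> /eqP|/negPn/eqP].
case/mem_faces: fc => j [b [jc fE]].
have face i (a : bool) : i \in c.2 ->
    (c.1 + (if a then unit_vec i else 0), (c.2 :\ i)%SET) \in faces c.
  by move=> ic; apply/mem_faces; exists i, a.
have := w_closed c; rewrite /coboundary (bigD1 j) //= [X in _ + X]big1 ?addr0.
  move=> /mulz_sign_eq0; have fx := face j true jc; have f0 := face j false jc.
  rewrite /= addr0 in f0; rewrite /= in fx.
  have ne : (c.1 + unit_vec j, (c.2 :\ j)%SET) != (c.1, (c.2 :\ j)%SET).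
    apply/eqP => -[/rowP/(_ j)]; rewrite mxE unit_vecE eqxx => /eqP.
    by rewrite -subr_eq0 addrAC subrr add0r.
  move: wf; rewrite fE in w0 *; case: b w0 {fE none} => /= w0.
    by rewrite (w0 _ f0) ?subr0; [move=> /[swap] -> /eqP|rewrite eq_sym].
  rewrite addr0 in w0 *; rewrite (w0 _ fx) // sub0r => /[swap] /eqP.
  by rewrite oppr_eq0 => /eqP -> /eqP.
move=> i /andP[ic ij]; have ne y z : (y, (c.2 :\ i)%SET) != (z, (c.2 :\ j)%SET) :> cell.
  by apply/eqP => -[_ /setP/(_ j)]; rewrite !inE eqxx jc eq_sym ij.
have f1 := face i true ic; have f0 := face i false ic; rewrite /= addr0 in f0.
by rewrite (w0 _ f1) ?(w0 _ f0) ?fE ?ne // subrr mul0rz.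
Qed.

(* [p] and the new face [q] share the cube on the side [up] of [p] in
   direction [k]; [q] is the face of that cube on the side [up'] in direction [j]. *)
Lemma next_plaquette (p : cell) (k : 'I_4) (up : bool) :
  w p != 0 -> k \notin p.2 ->
  exists q j (up' : bool), [/\ w q != 0, q.2 = ((k |: p.2) :\ j)%SET, j \in k |: p.2,
    forall i, center q i = center p i + (if up then 1 else -1) *+ (i == k)
                           + (if up' then 1 else -1) *+ (i == j) &
    j = k -> up' = up].
Proof.
case: p => x J /= wp kJ; pose c : cell := (x - (if up then 0 else unit_vec k), k |: J).
have kc : k \in c.2 by rewrite !inE eqxx.
have cJ : ((k |: J) :\ k)%SET = J by rewrite setU1K.
have pE : (x, J) = (c.1 + (if ~~ up then unit_vec k else 0), (c.2 :\ k)%SET).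
  by rewrite /c /= cJ; case: (up); rewrite /= ?subr0 ?addr0 ?subrK.
have pc : (x, J) \in faces c by apply/mem_faces; exists k, (~~ up).
have [q qc /andP[qp wq]] := second_face pc wp.
case/mem_faces: qc => j [b [jc qE]]; exists q, j, b; split=> //; first by rewrite qE.
- move=> i; rewrite qE pE !center_face //.
  by case: (up); rewrite /= mulNrn ?addrK ?subrK.
- move=> jk; apply: contraNeq qp => bup; rewrite qE pE jk.
  by move: bup; case: (up); case: (b).
Qed.

(** The centre moves by 2 in direction [k] when [q] is the opposite face of the cube ([j = k]), and
    otherwise by 1 in each of the directions [k] and [j]. *)
Lemma center_offset (p q : cell) (k j : 'I_4) (up up' : bool) :
  (forall i, center q i = center p i + (if up then 1 else -1) *+ (i == k)
                           + (if up' then 1 else -1) *+ (i == j)) ->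
  (j = k -> up' = up) ->
  [/\ (if up then 1 else -2) <= center q k - center p k <= (if up then 2 else -1),
      forall i, i != k -> i != j -> center q i = center p i &
      forall i, i != k -> -1 <= center q i - center p i <= 1].
Proof.
move=> qE jk; split=> [|i /negPf ik /negPf ij|i /negPf ik].
- rewrite qE eqxx mulr1n; have [/esym/jk ->|_] := eqVneq k j.
    by rewrite mulr1n; move: (center p k) => x; case: (up); clear; lia.
  by rewrite mulr0n; move: (center p k) => x; case: (up); clear; lia.
- by rewrite qE ik ij !addr0.
rewrite qE ik; move: (center p i) => x; case: (i == j); rewrite ?mulr0n ?mulr1n.
  by case: (up'); clear; lia.
by clear; lia.
Qed.

(* Closedness gives a further plaquette in each of the four cubes around [p],
   and a sixth one by crossing the first of these into the next cube. *)
Lemma six_plaquettes (p : cell) : cell_dim p = 2%N -> w p != 0 ->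
  exists l : seq cell, [/\ uniq l, size l = 6%N &
    {in l, forall q, w q != 0 /\ cell_dim q = 2%N}].
Proof.
move=> p2 wp.
have : #|~: p.2| == 2%N.
  by rewrite finset.cardsCs finset.setCK card_ord; move: p2; rewrite /cell_dim => ->.
case/cards2P => k [l [kl pC]].
have inC i : (i \notin p.2) = (i == k) || (i == l).
  by have /setP/(_ i) := pC; rewrite !inE.
have kp : k \notin p.2 by rewrite inC eqxx.
have lp : l \notin p.2 by rewrite inC eqxx orbT.
have lk : (l == k) = false by rewrite eq_sym (negPf kl).
have dimE (q q' : cell) i j : cell_dim q = 2%N -> i \notin q.2 -> j \in i |: q.2 ->
    q'.2 = ((i |: q.2) :\ j)%SET -> cell_dim q' = 2%N.
  rewrite /cell_dim => q2 iq jq ->; apply: succn_inj.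
  by have := cardsU1 i q.2; rewrite (cardsD1 j) jq iq q2 !add1n.
(* The directions [k] and [l] normal to [p], with two sides each, give the four cubes around [p]. *)
have [q1 [j1 [s1 [w1 q1E j1p c1 e1]]]] := next_plaquette true wp kp.
have [q2 [j2 [s2 [w2 q2E j2p c2 e2]]]] := next_plaquette false wp kp.
have [q3 [j3 [s3 [w3 q3E j3p c3 e3]]]] := next_plaquette true wp lp.
have [q4 [j4 [s4 [w4 q4E j4p c4 e4]]]] := next_plaquette false wp lp.
have j1q : j1 \notin q1.2 by rewrite q1E !inE eqxx.
(* Direction [j1] is normal to [q1], and side [s1] leads out of the cube shared by [p] and [q1]. *)
have [q5 [j5 [s5 [w5 q5E j5p c5 e5]]]] := next_plaquette s1 w1 j1q.
have d1 := dimE _ _ _ _ p2 kp j1p q1E; have d2 := dimE _ _ _ _ p2 kp j2p q2E.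
have d3 := dimE _ _ _ _ p2 lp j3p q3E; have d4 := dimE _ _ _ _ p2 lp j4p q4E.
have d5 := dimE _ _ _ _ d1 j1q j5p q5E.
exists [:: p; q1; q2; q3; q4; q5]; split=> //; last first.
  by move=> q; rewrite !inE => /or4P[||| /or3P[]] /eqP ->.
have jl i : i \in k |: p.2 -> (i == l) = false.
  by move=> ik; apply/eqP => il; move: ik; rewrite il !inE lk (negPf lp).
have jk i : i \in l |: p.2 -> (i == k) = false.
  by move=> il; apply/eqP => ik; move: il; rewrite ik !inE (negPf kl) (negPf kp).
have [c1k c1l _] := @center_offset p q1 k j1 true s1 c1 e1.
have [c2k c2l c2n] := @center_offset p q2 k j2 false s2 c2 e2.
have [c3l c3k c3n] := @center_offset p q3 l j3 true s3 c3 e3.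
have [c4l c4k c4n] := @center_offset p q4 l j4 false s4 c4 e4.
have [c5j _ _] := @center_offset q1 q5 j1 j5 s1 s5 c5 e5.
have {}c1l : center q1 l = center p l by rewrite c1l // ?lk // eq_sym (jl _ j1p).
have {}c2l : center q2 l = center p l by rewrite c2l // ?lk // eq_sym (jl _ j2p).
have {}c3k : center q3 k = center p k by rewrite c3k // eq_sym (jk _ j3p).
have {}c4k : center q4 k = center p k by rewrite c4k // eq_sym (jk _ j4p).
have ne i (a b : cell) : center a i != center b i -> a != b by apply: contraNneq => ->.
(* If [j1 = k], then [q1] is at offset 2 from [p] along [k] and [q5] at offset at least 3, beyond
   all others. If not, [q5] is at distance at least 2 from [p] along [j1], where the others are at
   distance at most 1. *)
have q5_new : {in [:: p; q1; q2; q3; q4], forall q, q5 != q}.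
  have [j1k|j1k] := eqVneq j1 k.
    have : 2 <= center q1 k - center p k.
      rewrite c1 -j1k eqxx (e1 j1k) !mulr1n; move: (center p j1) => x; clear; lia.
    move: c5j; rewrite (e1 j1k) j1k => c5k c1k' q.
    by rewrite !inE => /or4P[||| /orP[]] /eqP ->; apply: (ne k); move: c5k c1k' c1k c2k c3k c4k;
      clear; lia.
  have j1l : j1 != l by rewrite (jl _ j1p).
  have n1 : center q1 j1 - center p j1 = if s1 then 1 else -1.
    by rewrite c1 (negPf j1k) eqxx mulr0n mulr1n addr0 addrAC subrr add0r.
  have := c2n _ j1k; have := c3n _ j1l; have := c4n _ j1l => n4 n3 n2.
  move=> q; rewrite !inE => /or4P[||| /orP[]] /eqP ->; apply: (ne j1);
    move: c5j n1 n2 n3 n4; case: (s1); clear; lia.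
rewrite -[[:: p; q1; q2; q3; q4; q5]]/([:: p; q1; q2; q3; q4] ++ [:: q5]) cats1 rcons_uniq.
apply/andP; split.
  by apply/negP => /q5_new; rewrite eqxx.
rewrite /= !inE !negb_or.
by rewrite (@ne k p q1) ?(@ne k p q2) ?(@ne l p q3) ?(@ne l p q4) ?(@ne k q1 q2) ?(@ne k q1 q3)
  ?(@ne k q1 q4) ?(@ne k q2 q3) ?(@ne k q2 q4) ?(@ne l q3 q4) //;
  move: c1k c1l c2k c2l c3k c3l c4k c4l; clear; lia.
Qed.
End SixPlaquettes.

(** * Clusters of edges in a box *)

Definition adj M : rel (pcells M 1) :=
  [rel e e' | [exists p : pcells M 2,
                 (val e \in faces (val p)) && (val e' \in faces (val p))]].

Lemma adj_sym M : symmetric (@adj M).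
Proof. by move=> e e'; rewrite /adj /=; under eq_existsb do rewrite andbC. Qed.

(** A crude count: 8 choices of a direction and side give the plaquette, and 8 more give one of its
    edges. Cells outside the box are sent to the default [e]. *)
Lemma adj_degree M (e : pcells M 1) : (#|@adj M e| <= 64)%N.
Proof.
pose f (t : ('I_4 * bool) * ('I_4 * bool)) : cell :=
  let: ((j, b), (i, a)) := t in
  ((val e).1 - (if b then unit_vec j else 0) + (if a then unit_vec i else 0),
   ((j |: (val e).2) :\ i)%SET).
pose g t : pcells M 1 := insubd e (f t).
apply: (@leq_trans #|codom g|); last first.
  by apply: leq_trans (leq_image_card _ _) _; rewrite !card_prod card_ord card_bool.
apply/subset_leq_card/fintype.subsetP => e' /existsP[p /andP[]].
move=> /mem_faces[j [b [jp eE]]] /mem_faces[i [a [ip e'E]]].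
suff e'f : val e' = f ((j, b), (i, a)).
  apply/codomP; exists ((j, b), (i, a)); apply: val_inj.
  by rewrite /g insubdK // -e'f (valP e').
by rewrite /f eE e'E /= addrK finset.setD1K.
Qed.

Definition radius (r : nat) (c : cell) : Prop := forall i, - r%:Z <= c.1 0 i <= r%:Z.

Lemma face_shift (c f : cell) i : f \in faces c -> 0 <= f.1 0 i - c.1 0 i <= 1.
Proof.
case/mem_faces => j [b [_ ->]] /=; rewrite mxE; move: (c.1 0 i) => x.
by case: b; rewrite ?unit_vecE ?mxE; [case: (i == j)|]; clear; lia.
Qed.

Lemma radius_face r (c f : cell) : f \in faces c -> radius r f -> radius r.+1 c.
Proof. by move=> /face_shift fc fr i; have := fc i; have := fr i; clear; lia. Qed.

Lemma radius_cofaces r (c f g : cell) : f \in faces c -> g \in faces c -> radius r f -> radius r.+1 g.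
Proof.
by move=> /face_shift fc /face_shift gc fr i; have := fc i; have := gc i; have := fr i; clear; lia.
Qed.

Lemma radius_le r r' c : (r <= r')%N -> radius r c -> radius r' c.
Proof. by move=> rr cr i; have := cr i; move: rr; clear; lia. Qed.

Lemma radius_pcells N k r c : (r < N)%N -> cell_dim c = k -> radius r c -> c \in pcells N k.
Proof.
move=> rN <- cr; rewrite mem_pcells eqxx; apply/forall_inP => I _; rewrite in_box.
apply/forallP => i; rewrite /corner mxE summxE.
under eq_bigr => j _ do rewrite unit_vecE.
have -> : \sum_(j in I) (i == j)%:R = (i \in I)%:R :> int.
  have [iI|iI] := boolP (i \in I).
    by rewrite (bigD1 i) //= eqxx big1 ?addr0 // => j /andP[_ /negPf]; rewrite eq_sym => ->.
  by rewrite big1 // => j jI; case: eqP => // ij; rewrite ij jI in iI.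
by have := cr i; move: (c.1 0 i) rN => x; case: (i \in I); clear; lia.
Qed.

(** Two edges of one plaquette have base points that differ by at most 1 in each coordinate, and a
    path without repetition in [C] has at most [#|C|] steps. *)
Lemma rooted_radius M (e : pcells M 1) (C : {set pcells M 1}) r a :
  rooted (@adj M) [:: e] C -> a \in C -> radius r (val e) -> radius (r + #|C|) (val a).
Proof.
move=> /rootedP CP /CP[_ /[!inE] /eqP -> [eC /connectP[p]]] + + er.
case/shortenP => {}p ep up _ ->.
have pC : {subset p <= C}.
  move=> b; elim: p (e) ep {up eC er} => //= c p IH x /andP[/and3P[_ cC _] cp].
  by rewrite inE => /predU1P[->//|]; apply: IH cp.
apply: (@radius_le (r + size p)).
  rewrite leq_add2l; move/andP: up => [_ up]; rewrite -(card_uniqP up).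
  by apply/subset_leq_card/fintype.subsetP.
elim: p (e) r er ep {up eC pC} => [|c p IH] x r xr /=; first by rewrite addn0.
case/andP=> /and3P[_ _ /existsP[q /andP[xq cq]]] cp; rewrite addnS -addSn.
by apply: IH cp; apply: radius_cofaces xq cq xr.
Qed.

Lemma coboundary_neq0 n (u : cell -> 'Z_n) c : coboundary u c != 0 ->
  exists2 f, f \in faces c & u f != 0.
Proof.
move=> uc; apply/hasP; apply: contraNT uc => /hasPn u0; apply/eqP.
by rewrite (@eq_coboundary _ _ (fun=> 0)) ?coboundary0 // => f /u0/negPn/eqP.
Qed.

(** * Factorisation and bounds for box weights *)

Section Weights.
Variables (R : realType) (n : nat) (rho : 'Z_n -> R[i]).
Hypothesis rho_rep : faithful_unitary_rep rho.

Local Notation pconf := (pconf n).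

Lemma varphi0 r : varphi rho r 0 = 1.
Proof. by rewrite /varphi subrr mulr0 expR0. Qed.

Lemma varphi_gt0 r g : 0 < varphi rho r g. Proof. exact: expR_gt0. Qed.

Lemma varphi_le1 r g : 0 <= r -> varphi rho r g <= 1.
Proof.
move=> r0; rewrite varphiE // -expRD -[leRHS]expR0 ler_expR.
by rewrite -[X in _ + X]mulr1 mulNr -mulrN -mulrDr mulr_ge0_le0 // subr_le0 Re_rho_le1.
Qed.

Lemma plaquette_factor0 beta : plaquette_factor rho beta 0 = 1.
Proof. by case: beta => [b||] /=; rewrite ?varphi0 ?eqxx. Qed.

Lemma plaquette_factor_ge0 beta g : 0 <= plaquette_factor rho beta g.
Proof. by case: beta => [b||] /=; rewrite ?ler0n // ltW // varphi_gt0. Qed.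

Lemma plaquette_factor_le1 beta g : (0 <= beta)%E -> plaquette_factor rho beta g <= 1.
Proof. by case: beta => [b||] //= b0; [apply: varphi_le1|rewrite lern1 leq_b1]. Qed.

Lemma edge_factor0 N kappa e : edge_factor rho N kappa e 0 = 1.
Proof. by rewrite /edge_factor varphi0 eqxx expr1n if_same. Qed.

Lemma edge_factor_ge0 N kappa e g : 0 <= edge_factor rho N kappa e g.
Proof. by rewrite /edge_factor; case: ifP => _; rewrite ?sqr_ge0 ?ler0n. Qed.

Lemma edge_factor_le N kappa e g : edge_factor rho N kappa e g <= varphi rho kappa g ^+ 2.
Proof.
rewrite /edge_factor; case: ifP => // _; case: eqP => [->|_]; rewrite ?sqr_ge0 //.
by rewrite varphi0 expr1n.
Qed.

Lemma box_weight_ge0 N beta kappa M (s : pconf M) : 0 <= box_weight rho N beta kappa s.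
Proof. by rewrite mulr_ge0 // prodr_ge0 // => *; rewrite ?edge_factor_ge0 ?sqr_ge0. Qed.

Lemma ext0 M : ext (0 : pconf M) =1 (fun=> 0).
Proof. by move=> c; rewrite /ext; case: insub => // e; rewrite ffunE. Qed.

Lemma box_weight0 N beta kappa M : box_weight rho N beta kappa (0 : pconf M) = 1.
Proof.
rewrite /box_weight !big1 ?mulr1 // => [p _|e _]; last by rewrite ffunE edge_factor0.
by rewrite (@eq_coboundary _ _ (fun=> 0)) ?coboundary0 ?plaquette_factor0 ?expr1n // => c _; rewrite ext0.
Qed.

Lemma ext_neq0 M (s : pconf M) c : ext s c != 0 -> exists2 e : pcells M 1, c = val e & s e != 0.
Proof.
by rewrite /ext; case: insubP => [e _ <-|]; [exists e|rewrite eqxx].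
Qed.

(** A plaquette on which both parts have non-zero coboundary would contain a supported edge of each
    and make the two adjacent. So at every plaquette one part contributes the factor 1. *)
Lemma box_weight_factoring N beta kappa M : (N <= M)%N ->
  factoring (@adj M) (@box_weight R n rho N beta kappa M).
Proof.
move=> NM A s sepA; rewrite [RHS]mulrACA -!big_split; congr (_ * _).
  apply: eq_bigr => e _; rewrite !ffunE inE /=; case: ifP => _;
  by rewrite edge_factor0 ?mulr1 ?mul1r.
rewrite big_seq [RHS]big_seq; apply: eq_bigr => p pN.
pose sA := restr A s; pose sB := restr (~: A) s.
have extD c : ext s c = ext sA c + ext sB c.
  by rewrite /ext; case: insub => [e|]; rewrite ?addr0 // -restrD.
rewrite /= -exprMn (@eq_coboundary _ _ (fun c => ext sA c + ext sB c)) // coboundaryD -/sA -/sB.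
have [->|nA] := eqVneq (coboundary (ext sA) p) 0.
  by rewrite add0r plaquette_factor0 mul1r.
have [->|nB] := eqVneq (coboundary (ext sB) p) 0.
  by rewrite addr0 plaquette_factor0 mulr1.
have [f pa /ext_neq0[a fa sa]] := coboundary_neq0 nA.
have [g pb /ext_neq0[b gb sb]] := coboundary_neq0 nB.
rewrite ffunE in sa; rewrite ffunE inE /= in sb.
case: ifP sa; rewrite ?eqxx // => aA sa; case: ifP sb; rewrite ?eqxx // => /negP/negP bA sb.
have /existsP[] := sepA a b aA bA sa sb.
by exists [` pcells_le NM pN]%fset; rewrite /= -fa -gb pa pb.
Qed.

Lemma prod_le1 (I : Type) (r : seq I) (F : I -> R) :
  (forall i, 0 <= F i <= 1) -> \prod_(i <- r) F i <= 1.
Proof. by move=> F01; apply: prodr_ile1 => i _; apply: F01. Qed.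

Lemma plaquette_factor2_01 beta g : (0 <= beta)%E -> 0 <= plaquette_factor rho beta g ^+ 2 <= 1.
Proof. by move=> b0; rewrite sqr_ge0 exprn_ile1 ?plaquette_factor_ge0 ?plaquette_factor_le1. Qed.

Lemma box_weight_le_prod N beta kappa M (s : pconf M) b : 
  \prod_(p <- pcells N 2) plaquette_factor rho beta (coboundary (ext s) p) ^+ 2 <= b ->
  box_weight rho N beta kappa s <= (\prod_e varphi rho kappa (s e) ^+ 2) * b.
Proof.
move=> pb; apply: ler_pM => //; try by rewrite prodr_ge0 // => *; rewrite ?edge_factor_ge0 ?sqr_ge0.
by apply: ler_prod => e _; rewrite edge_factor_ge0 edge_factor_le.
Qed.

Lemma box_weight_le N beta kappa M (s : pconf M) : (0 <= beta)%E ->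
  box_weight rho N beta kappa s <= \prod_e varphi rho kappa (s e) ^+ 2.
Proof.
move=> b0; rewrite -[leRHS]mulr1; apply: box_weight_le_prod.
by apply: prod_le1 => p; apply: plaquette_factor2_01.
Qed.

Lemma alpha1_ge0 r : 0 <= alpha1 rho r.
Proof. by rewrite /alpha1; elim/big_rec: _ => // g x _ x0; rewrite le_max x0 orbT. Qed.

Lemma le_alpha1 r g : g != 0 -> varphi rho r g ^+ 2 <= alpha1 rho r.
Proof. by move=> g0; apply: (le_bigmax_cond _ (fun g => varphi rho r g ^+ 2)). Qed.

Lemma plaquette_support N r M (s : pconf M) p : (r.+1 < N)%N ->
  (forall e, s e != 0 -> radius r (val e)) -> cell_dim p = 2%N ->
  coboundary (ext s) p != 0 -> p \in pcells N 2.
Proof.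
move=> rN sr pd /coboundary_neq0[f fp /ext_neq0[e fE /sr er]].
by apply: (@radius_pcells _ _ r.+1) => //; apply: radius_face fp _; rewrite fE.
Qed.

Lemma cell_dim_pcells N k c : c \in pcells N k -> cell_dim c = k.
Proof. by rewrite mem_pcells => /andP[/eqP]. Qed.

(** Plaquettes touching the support have base points within radius [r.+1] and corners one unit
    further, hence lie in the box [N]. All additional factors in the box [M] are taken at 0 and
    equal 1. *)
Lemma inner_weight N M r beta kappa (s : pconf M) : (N <= M)%N -> (r.+1 < N)%N ->
  (forall e, s e != 0 -> radius r (val e)) ->
  box_weight rho N beta kappa s = box_weight rho M beta kappa s.
Proof.
move=> NM rN sr; congr (_ * _).
  apply: eq_bigr => e _; have [->|/sr er] := eqVneq (s e) 0; first by rewrite !edge_factor0.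
  rewrite /edge_factor (valP e); suff -> : val e \in pcells N 1 by [].
  by apply: radius_pcells er; [apply: ltnW|apply: cell_dim_pcells (valP e)].
pose F p := plaquette_factor rho beta (coboundary (ext s) p) ^+ 2.
rewrite -/(F _) [RHS](bigID [in pcells N 2]) /= [X in _ = _ * X]big_seq_cond.
rewrite [X in _ = _ * X]big1 ?mulr1 => [|p /andP[pM pN]]; last first.
  rewrite /F; have [->|p0] := eqVneq (coboundary (ext s) p) 0.
    by rewrite plaquette_factor0 expr1n.
  by rewrite (plaquette_support rN sr (cell_dim_pcells pM) p0) in pN.
rewrite -[RHS]big_filter; apply: perm_big; apply: uniq_perm; rewrite ?filter_uniq ?fset_uniq //.
by move=> p; rewrite mem_filter andb_idr // => /(pcells_le NM).
Qed.

(** If the weights differ, some plaquette carries a non-zero coboundary. This coboundary is closed,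
    so there are six such plaquettes, all inside the box by the radius condition; each costs
    [alpha1] and the rest at most 1. *)
Lemma six_weight N r b kappa (s : pconf N) : (r.+1 < N)%N -> 0 <= b ->
  (forall e, s e != 0 -> radius r (val e)) ->
  box_weight rho N b%:E kappa s != box_weight rho N +oo%E kappa s ->
  box_weight rho N b%:E kappa s <= (\prod_e varphi rho kappa (s e) ^+ 2) * alpha1 rho b ^+ 6.
Proof.
move=> rN b0 sr ne; apply: box_weight_le_prod; set w := coboundary (ext s).
have [q wq qd] : exists2 q, w q != 0 & cell_dim q = 2%N.
  have /hasP[q qN wq] : has (fun q => w q != 0) (pcells N 2).
    apply: contraNT ne => /hasPn w0; apply/eqP; congr (_ * _).
    rewrite big_seq [RHS]big_seq; apply: eq_bigr => q /w0/negPn/eqP wq.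
    by rewrite -/w wq !plaquette_factor0.
  by exists q => //; apply: cell_dim_pcells qN.
have wclosed c : coboundary w c = 0 by apply: coboundaryK.
have [l [ul l6 lP]] := six_plaquettes wclosed qd wq.
have lN : {subset l <= pcells N 2}.
  by move=> p /lP[wp pd]; apply: plaquette_support rN sr pd wp.
pose F p := varphi rho b (w p) ^+ 2.
have F01 p : 0 <= F p <= 1 by apply: (@plaquette_factor2_01 b%:E).
rewrite -/(F _) (bigID [in l]) /= -[leRHS]mulr1.
have F0 (P : pred cell) (t : seq cell) : 0 <= \prod_(p <- t | P p) F p.
  by rewrite prodr_ge0 // => p _; case/andP: (F01 p).
apply: ler_pM => //; last by apply: prodr_ile1 => p _; apply: F01.
rewrite -big_filter (perm_big l) /=; last first.
  apply: uniq_perm; rewrite ?filter_uniq ?fset_uniq // => p.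
  by rewrite mem_filter andb_idr // => /lN.
have -> : alpha1 rho b ^+ 6 = \prod_(p <- l) alpha1 rho b.
  by rewrite big_const_seq count_predT l6 iter_mulr_1.
rewrite big_seq [leRHS]big_seq.
apply: ler_prod => p pl; have /andP[-> _] := F01 p.
by rewrite le_alpha1 //; have [] := lP _ pl.
Qed.

End Weights.

(** * Comparison of box measures *)

Section Compare.
Variables (R : realType) (n : nat) (rho : 'Z_n -> R[i]).
Hypothesis rho_rep : faithful_unitary_rep rho.
Variable kappa : R.

Local Notation pconf := (pconf n).

(** This is [(1 + alpha0) ^+ 2 - 1], the total weight of the non-zero pairs of values at one
    edge. *)
Definition pair_alpha : R := alpha0 rho kappa * (2 + alpha0 rho kappa).

Lemma alpha0_ge0 r : 0 <= alpha0 rho r.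
Proof. by rewrite sumr_ge0 // => g _; rewrite sqr_ge0. Qed.

Lemma pair_alpha_ge0 : 0 <= pair_alpha.
Proof. by rewrite mulr_ge0 ?addr_ge0 ?alpha0_ge0. Qed.

Lemma sum_pair_varphi :
  \sum_(v : 'Z_n * 'Z_n | v != (0, 0)) varphi rho kappa v.1 ^+ 2 * varphi rho kappa v.2 ^+ 2
  = pair_alpha.
Proof.
pose f g := varphi rho kappa g ^+ 2.
have f0 : f 0 = 1 by rewrite /f varphi0 expr1n.
have sumf : \sum_g f g = 1 + alpha0 rho kappa by rewrite (bigD1 0) //= f0.
have : (\sum_g f g) * (\sum_g f g) = \sum_(v : 'Z_n * 'Z_n) f v.1 * f v.2.
  by rewrite big_distrlr /= pair_bigA.
rewrite (bigD1 (0, 0)) //= f0 mulr1 sumf -/(f _) => E.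
by apply: (addrI 1); rewrite -E /pair_alpha; ring.
Qed.

(** The exponent 64 is the degree bound, and [1 / 216] is [3 / 2] times [1 / 324], which leaves room
    for a geometric decay in the cluster size. The power is bounded by 2 through six squarings with
    rounded constants. *)
Lemma animal_constant (z : R) : 0 <= z -> z <= 1 / 216 -> z * (1 + 2 * z) ^+ 64 <= 2 * z.
Proof.
move=> z0 z216; rewrite mulrC ler_wpM2r //.
have sq (k : nat) (b : R) (c : R) : (1 + 2 * z) ^+ k <= b -> b ^+ 2 <= c ->
    (1 + 2 * z) ^+ (k * 2) <= c.
  move=> kb bc; apply: le_trans bc; rewrite exprM lerXn2r // nnegrE.
    by rewrite exprn_ge0 // addr_ge0 // mulr_ge0.
  by apply: le_trans kb; rewrite exprn_ge0 // addr_ge0 // mulr_ge0.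
apply: (@sq 32 (135 / 100)); last by lra.
apply: (@sq 16 (1161 / 1000)); last by lra.
apply: (@sq 8 (10773 / 10000)); last by lra.
apply: (@sq 4 (10379 / 10000)); last by lra.
apply: (@sq 2 (10187 / 10000)); last by lra.
apply: (@sq 1 (10093 / 10000)); last by lra.
by rewrite expr1; lra.
Qed.

Hypothesis small : pair_alpha <= 1 / 324.

Lemma animal_sum (A : R) (m M : nat) (e : pcells M 1) : 0 <= A ->
  \sum_(s : pconf M * pconf M | (e \in supp2 s) && rooted (@adj M) [:: e] (supp2 s))
     (A + (m <= #|supp2 s|)%N%:R) *
     \prod_a (varphi rho kappa (s.1 a) ^+ 2 * varphi rho kappa (s.2 a) ^+ 2)
  <= 2 * pair_alpha * A + (2 / 3) ^+ m / 2.
Proof.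
move=> A0; have x0 := pair_alpha_ge0; have x324 := small.
have h23 : 0 <= 2 / 3 :> R by lra.
have z0 : 0 <= 3 / 2 * pair_alpha by lra.
have f0 : varphi rho kappa 0 ^+ 2 = 1 by rewrite varphi0 expr1n.
under eq_bigr => s _ do rewrite mulrDl.
rewrite big_split /= -big_distrr /=.
have sumE (P : pred {set pcells M 1}) := @sum_supp2 _ _ R (fun g => varphi rho kappa g ^+ 2) P f0.
apply: lerD.
  rewrite [leRHS]mulrC ler_wpM2l //.
  rewrite (sumE (fun C => (e \in C) && rooted (@adj M) [:: e] C)) sum_pair_varphi.
  apply: rooted_sum1 (@adj_degree M) _ _ _ => //; first by rewrite mulr_ge0.
  by apply: animal_constant => //; lra.
rewrite (eq_bigr (fun s : pconf M * pconf M => if (m <= #|supp2 s|)%N then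
     \prod_a (varphi rho kappa (s.1 a) ^+ 2 * varphi rho kappa (s.2 a) ^+ 2) else 0));
  last by move=> s _; case: ifP; rewrite ?mul1r ?mul0r.
rewrite -big_mkcondr /=.
rewrite (sumE (fun C => (e \in C) && rooted (@adj M) [:: e] C && (m <= #|C|)%N)) sum_pair_varphi.
(* For [m <= #|C|], [x ^+ #|C|] is at most [(2 / 3) ^+ m * (3 / 2 * x) ^+ #|C|]; the enlarged weight
   [3 / 2 * x] still satisfies the cluster bound. *)
apply: le_trans (_ : (2 / 3) ^+ m * \sum_(C : {set pcells M 1} | (e \in C) && rooted (@adj M) [:: e] C)
   (3 / 2 * pair_alpha) ^+ #|C| <= _).
  rewrite big_distrr /=; apply: ler_sum_dom => C; last by rewrite mulr_ge0 ?exprn_ge0.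
  case/andP=> -> mC; split=> //; rewrite -(subnKC mC) !exprD mulrA -exprMn.
  rewrite (_ : 2 / 3 * (3 / 2 * pair_alpha) = pair_alpha); last by field.
  by rewrite ler_wpM2l ?exprn_ge0 // lerXn2r ?nnegrE //; lra.
rewrite ler_wpM2l ?exprn_ge0 //.
apply: (@le_trans _ _ (2 * (3 / 2 * pair_alpha))); last by lra.
apply: rooted_sum1 (@adj_degree M) _ _ _; [lra|lra|].
by apply: animal_constant; lra.
Qed.

(* [m] is a cut-off: clusters with at least [m] edges only contribute to the
   geometric term, smaller ones gain the factor [A]. *)
Lemma box_compare (N1 N2 M : nat) (b1 b2 : \bar R) (l : seq (pcells M 1))
    (F : pconf M -> R) (A : R) (m : nat) :
  (N1 <= M)%N -> (N2 <= M)%N -> (0 <= b1)%E -> (0 <= b2)%E ->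
  (forall s, `|F s| <= 1) -> (forall s t : pconf M, {in l, s =1 t} -> F s = F t) -> 0 <= A ->
  (forall e (t : pconf M * pconf M), e \in l ->
     bad (@box_weight R n rho N1 b1 kappa M) (@box_weight R n rho N2 b2 kappa M) t ->
     e \in supp2 t -> rooted (@adj M) [:: e] (supp2 t) -> (#|supp2 t| < m)%N ->
     box_weight rho N1 b1 kappa t.1 * box_weight rho N2 b2 kappa t.2 <=
     A * \prod_a (varphi rho kappa (t.1 a) ^+ 2 * varphi rho kappa (t.2 a) ^+ 2)) ->
  `|(\sum_(s : pconf M) box_weight rho N1 b1 kappa s * F s)
      / (\sum_(s : pconf M) box_weight rho N1 b1 kappa s)
    - (\sum_(s : pconf M) box_weight rho N2 b2 kappa s * F s)
      / (\sum_(s : pconf M) box_weight rho N2 b2 kappa s)|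
  <= (size l)%:R * (4 * pair_alpha * A + (2 / 3) ^+ m).
Proof.
move=> N1M N2M b1_ge0 b2_ge0 F1 Floc A0 badA.
apply: le_trans (disagreement (@adj_sym M) (box_weight_ge0 rho N1 b1 kappa (M := M))
  (box_weight_ge0 rho N2 b2 kappa (M := M)) (box_weight0 rho N1 b1 kappa M)
  (box_weight0 rho N2 b2 kappa M) (box_weight_factoring rho b1 kappa N1M)
  (box_weight_factoring rho b2 kappa N2M) F1 Floc) _.
apply: le_trans (_ : 2 * \sum_(e <- l) (2 * pair_alpha * A + (2 / 3) ^+ m / 2) <= _); last first.
  rewrite big_const_seq count_predT iter_addr_0 -[X in 2 * X]mulr_natl mulrCA ler_wpM2l //.
  by rewrite mulrDr; lra.
rewrite ler_wpM2l // big_seq [leRHS]big_seq; apply: ler_sum => e el.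
apply: le_trans (animal_sum m e A0); apply: ler_sum_dom => s; last first.
  by rewrite mulr_ge0 ?addr_ge0 // prodr_ge0 // => a _; rewrite mulr_ge0 ?sqr_ge0.
case/and3P=> bs es rs; rewrite es rs; split=> //.
have p0 : 0 <= \prod_a (varphi rho kappa (s.1 a) ^+ 2 * varphi rho kappa (s.2 a) ^+ 2).
  by rewrite prodr_ge0 // => a _; rewrite mulr_ge0 ?sqr_ge0.
case: (leqP m #|supp2 s|) => ms; last by rewrite addr0; apply: (badA e).
rewrite mulrDl mul1r -[leLHS]add0r lerD ?mulr_ge0 // big_split /=.
by apply: ler_pM; rewrite ?box_weight_ge0 ?box_weight_le.
Qed.

(** A non-zero weight at [+oo] forces zero coboundary on every plaquette of the box, where all
    plaquette factors equal 1. *)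
Lemma flat_weight N M b (s : pconf M) : box_weight rho N +oo%E kappa s != 0 ->
  box_weight rho N b%:E kappa s = box_weight rho N +oo%E kappa s.
Proof.
rewrite mulf_eq0 negb_or => /andP[_ s0]; congr (_ * _).
rewrite big_seq [RHS]big_seq; apply: eq_bigr => p pN.
have p0 : coboundary (ext s) p = 0.
  move: s0; rewrite (big_rem p) //= mulf_eq0 negb_or expf_eq0 /=.
  by rewrite pnatr_eq0 eqb0 negbK => /andP[/eqP].
by rewrite p0 !plaquette_factor0.
Qed.

Lemma supp_radius M (e : pcells M 1) (t : pconf M * pconf M) r :
  rooted (@adj M) [:: e] (supp2 t) -> radius r (val e) ->
  forall a, ((t.1 a != 0) || (t.2 a != 0)) -> radius (r + #|supp2 t|) (val a).
Proof.
move=> rt er a ta; apply: rooted_radius rt _ er.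
by rewrite inE xpair_eqE negb_and.
Qed.

(** A cluster with fewer than [N - r.+1] edges that starts within radius [r] stays off the boundary
    of the box [N], so the two weights agree on it. Hence no small cluster is bad and [A = 0] is
    allowed. *)
Lemma box_compare_size (N M : nat) (b : \bar R) (l : seq (pcells M 1)) (F : pconf M -> R) r :
  (N <= M)%N -> (0 <= b)%E ->
  (forall s, `|F s| <= 1) -> (forall s t : pconf M, {in l, s =1 t} -> F s = F t) ->
  {in l, forall e, radius r (val e)} ->
  `|(\sum_(s : pconf M) box_weight rho N b kappa s * F s)
      / (\sum_(s : pconf M) box_weight rho N b kappa s)
    - (\sum_(s : pconf M) box_weight rho M b kappa s * F s)
      / (\sum_(s : pconf M) box_weight rho M b kappa s)|
  <= (size l)%:R * (2 / 3) ^+ (N - r.+1).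
Proof.
move=> NM b0 F1 Floc lr.
have <- : 4 * pair_alpha * 0 + (2 / 3) ^+ (N - r.+1) = (2 / 3) ^+ (N - r.+1) :> R.
  by rewrite mulr0 add0r.
apply: (@box_compare N M M b b l F 0 (N - r.+1)) => // e t el bt _ rt; rewrite ltn_subRL addSn => tm.
have tr := supp_radius rt (lr _ el); move: bt; rewrite /bad.
rewrite !(@inner_weight _ _ _ N M (r + #|supp2 t|)) ?eqxx // => a ta; apply: tr.
  by rewrite ta orbT.
by rewrite ta.
Qed.

(** Either [t.2] has weight 0 at [+oo] and the product vanishes, or the two weights agree on [t.2].
    In the second case they differ on [t.1], which pays for six plaquettes. *)
Lemma box_compare_flat (N : nat) (b : R) (l : seq (pcells N 1)) (F : pconf N -> R) r :
  0 <= b ->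
  (forall s, `|F s| <= 1) -> (forall s t : pconf N, {in l, s =1 t} -> F s = F t) ->
  {in l, forall e, radius r (val e)} ->
  `|(\sum_(s : pconf N) box_weight rho N b%:E kappa s * F s)
      / (\sum_(s : pconf N) box_weight rho N b%:E kappa s)
    - (\sum_(s : pconf N) box_weight rho N +oo%E kappa s * F s)
      / (\sum_(s : pconf N) box_weight rho N +oo%E kappa s)|
  <= (size l)%:R * (4 * pair_alpha * alpha1 rho b ^+ 6 + (2 / 3) ^+ (N - r.+1)).
Proof.
move=> b0 F1 Floc lr; have A0 : 0 <= alpha1 rho b ^+ 6 by rewrite exprn_ge0 ?alpha1_ge0.
apply: box_compare => // e t el bt _ rt; rewrite ltn_subRL addSn => tm.
have p0 (s : pconf N) : 0 <= \prod_a varphi rho kappa (s a) ^+ 2.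
  by rewrite prodr_ge0 // => a _; rewrite sqr_ge0.
have tr := supp_radius rt (lr _ el); rewrite big_split /=.
have [t20|t20] := eqVneq (box_weight rho N +oo%E kappa t.2) 0.
  by rewrite t20 mulr0; apply: mulr_ge0 => //; apply: mulr_ge0; apply: p0.
move: bt; rewrite /bad (flat_weight b t20) eqxx orbF => bt.
rewrite [leRHS]mulrA [alpha1 _ _ ^+ 6 * _]mulrC.
have w1_le : box_weight rho N b%:E kappa t.1 <=
    (\prod_a varphi rho kappa (t.1 a) ^+ 2) * alpha1 rho b ^+ 6.
  by apply: six_weight tm _ _ bt => // a ta; apply: tr; rewrite ta.
have w2_le : box_weight rho N +oo%E kappa t.2 <= \prod_a varphi rho kappa (t.2 a) ^+ 2.
  by apply: box_weight_le.
by apply: (ler_pM _ _ w1_le w2_le); apply: box_weight_ge0.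
Qed.

End Compare.

(** * Infinite volume *)

Section Limits.
Variable R : realType.

(** Box measures are compared on real observables, so the complex loop observable is treated by its
    imaginary and real parts, selected by [im]. *)
Definition part (im : bool) (z : R[i]) : R := if im then complex.Im z else complex.Re z.

Lemma partB im z w : part im (z - w) = part im z - part im w.
Proof. by case: im; case: z; case: w. Qed.

Lemma partM im (a : R) z : part im (a%:C * z) = a * part im z.
Proof. by case: im; case: z => c d /=; rewrite mul0r ?subr0 ?addr0. Qed.

Lemma part_sum im (I : finType) (F : I -> R[i]) : part im (\sum_i F i) = \sum_i part im (F i).
Proof. by apply: (big_morph (part im)); case: im => // -[a b] [c d]. Qed.

Lemma part_le im z : (`|part im z|%:C <= `|z|).
Proof.
case: im => /=; last exact: normc_ge_Re.
have -> : complex.Im z = - complex.Re (z * 'i%C) by rewrite ReiNIm opprK.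
rewrite normrN; apply: le_trans (normc_ge_Re _) _.
by rewrite normrM (normc_def 'i%C) /= expr2 mul0r add0r expr1n sqrtr1 mulr1.
Qed.

Lemma norm_le_parts z : `|z| <= (`|part false z| + `|part true z|)%:C.
Proof.
rewrite normc_def lecR -[leRHS]ger0_norm ?addr_ge0 // -sqrtr_sqr ler_sqrt ?sqr_ge0 //.
rewrite sqrrD !real_normK ?num_real // addrAC lerDl.
by rewrite mulrn_wge0 // mulr_ge0.
Qed.

Lemma tail_small (C e : R) r : 0 < e -> (\forall N \near \oo, C * (2 / 3) ^+ (N - r)%N < e)%classic.
Proof.
move=> e0; have h : `|2 / 3 : R| < 1 by rewrite ger0_norm; lra.
have /cvgrPdist_lt/(_ _ e0) [n0 _ Hn] := cvg_geometric C h.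
exists (n0 + r)%N => // N /= nN; have := Hn (N - r)%N; rewrite /= leq_subRL; last first.
  by apply: leq_trans nN; rewrite leq_addl.
rewrite addnC => /(_ nN); rewrite sub0r normrN /geometric /=.
exact: le_lt_trans (ler_norm _).
Qed.

Lemma cvg_near (u : nat -> R) (a e : R) : (u N @[N --> \oo] --> a)%classic -> 0 < e ->
  (\forall N \near \oo, `|a - u N| < e)%classic.
Proof. by move/cvgrPdist_lt => ua; apply: ua. Qed.

Lemma cvg_of_tail (u : nat -> R) (C : R) r :
  (forall N M, (r < N)%N -> (N <= M)%N -> `|u N - u M| <= C * (2 / 3) ^+ (N - r)) ->
  exists a : R, (u @ \oo --> a)%classic.
Proof.
move=> uC; suff /cvg_ex : cvg (u @ \oo)%classic by [].
apply/cauchy_cvgP/cauchy_exP => e e0.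
have [n0 _ Hn] := tail_small C r e0.
pose N := maxn n0 r.+1; exists (u N), N => // M /= NM; rewrite /ball /=.
apply: le_lt_trans (uC N M _ NM) _; first by rewrite leq_maxr.
by apply: Hn; rewrite /= leq_maxl.
Qed.

Lemma complex_cvg (z : nat -> R[i]) (a : bool -> R) :
  (forall im, (part im (z N) @[N --> \oo] --> a im)%classic) ->
  ((z : nat -> R[i]^o) @ \oo --> (a false +i* a true : R[i]^o))%classic.
Proof.
move=> za; apply/cvgrPdist_lt => e; rewrite ltcE /= => /andP[/eqP e_real e0].
have h (im : bool) := cvg_near (za im) (divr_gt0 e0 (ltr0Sn _ 1)).
near=> N.
have hF : `|a false - part false (z N)| < complex.Re e / 2 by near: N; apply: h.
have hT : `|a true - part true (z N)| < complex.Re e / 2 by near: N; apply: h.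
have := norm_le_parts ((a false +i* a true) - z N); rewrite !partB => zN.
apply: le_lt_trans zN _; rewrite ltcE /= e_real eqxx /=.
by rewrite [complex.Re e]splitr ltrD.
Unshelve. all: by end_near. Qed.

End Limits.

(** * Loop expectations in infinite volume *)

Section Final.
Variables (R : realType) (n : nat) (rho : 'Z_n -> R[i]).
Hypothesis rho_rep : faithful_unitary_rep rho.
Variables (kappa : R) (gamma : chain) (r : nat).
Hypothesis small : pair_alpha rho kappa <= 1 / 324.
Hypothesis gamma_edges : {in dom gamma, forall c, cell_dim c = 1%N}.
Hypothesis gamma_radius : {in dom gamma, forall c, radius r c}.

Local Notation E b N := (finite_volume_expectation rho N b kappa (L rho gamma)).

Lemma gamma_pcells N : (r < N)%N -> {subset dom gamma <= pcells N 1}.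
Proof. by move=> rN c cg; apply: radius_pcells rN (gamma_edges cg) (gamma_radius cg). Qed.

Definition path_edges M : seq (pcells M 1) := pmap insub (dom gamma).

Lemma size_path_edges M : (size (path_edges M) <= size (dom gamma))%N.
Proof. by rewrite size_pmap_sub count_size. Qed.

Lemma path_edges_radius M : {in path_edges M, forall e, radius r (val e)}.
Proof. by move=> e; rewrite mem_pmap_sub => /gamma_radius. Qed.

Definition part_loop im M (s : pconf n M) : R := part im (loop_value rho gamma (ext s)).

Lemma part_loop_le1 im M (s : pconf n M) : `|part_loop im s| <= 1.
Proof.
rewrite -lecR; apply: le_trans (part_le _ _) _.
by case: rho_rep => _ _ -> _; rewrite rmorph1.
Qed.

Lemma part_loop_local im M (s t : pconf n M) :
  {in path_edges M, s =1 t} -> part_loop im s = part_loop im t.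
Proof.
move=> st; rewrite /part_loop /loop_value big_seq [in RHS]big_seq; congr (part im (rho _)).
apply: eq_bigr => c cg; congr (_ *~ _); rewrite /ext; case: insubP => // e _ ec.
by apply: st; rewrite mem_pmap_sub ec.
Qed.

(** The configuration space is that of the larger box [M], so that expectations in two boxes can be
    compared on one space. *)
Lemma part_expectation im b N M : (N <= M)%N -> (r < N)%N -> b != -oo%E ->
  part im (E b N) = (\sum_(s : pconf n M) box_weight rho N b kappa s * part_loop im s) /
                    (\sum_(s : pconf n M) box_weight rho N b kappa s).
Proof.
move=> NM rN b_fin; rewrite (finite_volumeE rho_rep kappa NM b_fin (gamma_pcells rN)).
rewrite mulrC -fmorphV /= partM mulrC part_sum; congr (_ / _).
by apply: eq_bigr => s _; rewrite partM.
Qed.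

Lemma part_tail im b N M : (0 <= b)%E -> (r < N)%N -> (N <= M)%N ->
  `|part im (E b N) - part im (E b M)| <= (size (dom gamma))%:R * (2 / 3) ^+ (N - r.+1).
Proof.
move=> b0 rN NM; have b_fin : b != -oo%E by apply: contraTneq b0 => ->.
rewrite (part_expectation im NM rN b_fin).
rewrite (part_expectation im (leqnn M) (leq_trans rN NM) b_fin).
apply: le_trans (box_compare_size rho_rep small NM b0 (@part_loop_le1 im M)
  (@part_loop_local im M) (@path_edges_radius M)) _.
by rewrite ler_wpM2r ?exprn_ge0 ?ler_nat ?size_path_edges.
Qed.

Lemma part_flat im b N : 0 <= b -> (r < N)%N ->
  `|part im (E b%:E N) - part im (E +oo%E N)| <= 
  (size (dom gamma))%:R * (4 * pair_alpha rho kappa * alpha1 rho b ^+ 6 + (2 / 3) ^+ (N - r.+1)).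
Proof.
move=> b0 rN.
rewrite !(part_expectation im (leqnn N) rN) //.
apply: le_trans (box_compare_flat rho_rep small b0 (@part_loop_le1 im N)
  (@part_loop_local im N) (@path_edges_radius N)) _.
rewrite ler_wpM2r ?ler_nat ?size_path_edges // addr_ge0 ?exprn_ge0 //.
by rewrite mulr_ge0 ?exprn_ge0 ?alpha1_ge0 // mulr_ge0 // pair_alpha_ge0.
Qed.

Lemma part_cvg im b : (0 <= b)%E -> exists a : R, (part im (E b N) @[N --> \oo] --> a)%classic.
Proof.
move=> b0; apply: (@cvg_of_tail _ _ (size (dom gamma))%:R r.+1) => N M rN NM.
by apply: part_tail => //; apply: ltnW.
Qed.

Lemma expectation_cvg b : (0 <= b)%E -> exists a : bool -> R,
  (forall im, (part im (E b N) @[N --> \oo] --> a im)%classic) /\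
  infinite_volume_expectation rho b kappa (L rho gamma) = a false +i* a true.
Proof.
move=> b0; have [a aP] := choice (fun im => part_cvg im b0).
exists a; split=> //; apply: (@cvg_lim R[i]^o) (complex_cvg aP).
exact: norm_hausdorff.
Qed.

(** The constant 8 is 4 for each of the real and imaginary parts; the geometric term disappears in
    the limit. *)
Lemma expectation_flat b : 0 <= b ->
  `| infinite_volume_expectation rho b%:E kappa (L rho gamma)
     - infinite_volume_expectation rho +oo%E kappa (L rho gamma) | <=
  (8 * (size (dom gamma))%:R * pair_alpha rho kappa * alpha1 rho b ^+ 6)%:C.
Proof.
move=> b0; have [a [aP ->]] := @expectation_cvg b%:E b0.
have [c [cP ->]] := @expectation_cvg +oo%E (leey _).
apply: le_trans (norm_le_parts _) _; rewrite lecR !partB /=.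
suff ac im : `|a im - c im| <= 4 * (size (dom gamma))%:R * pair_alpha rho kappa * alpha1 rho b ^+ 6.
  by apply: le_trans (lerD (ac false) (ac true)) _; lra.
(* One third of [e] is spent on each of the two limits and one on the geometric term. *)
apply/ler_addgt0Pr => e e0; have e3 : 0 < e / 3 by lra.
near (\oo)%classic => N.
have hN : (r < N)%N by near: N; exists r.+1.
have h1 : `|a im - part im (E b%:E N)| < e / 3 by near: N; apply: (cvg_near (aP im)).
have h2 : `|c im - part im (E +oo%E N)| < e / 3 by near: N; apply: (cvg_near (cP im)).
have h3 : (size (dom gamma))%:R * (2 / 3) ^+ (N - r.+1) < e / 3 by near: N; apply: tail_small.
have := part_flat im b0 hN; rewrite mulrDr => h4.
have -> : a im - c im = (a im - part im (E b%:E N)) - (c im - part im (E +oo%E N)) +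
   (part im (E b%:E N) - part im (E +oo%E N)) by ring.
apply: le_trans (ler_normD _ _) _; apply: le_trans (lerD (ler_normB _ _) h4) _.
move: h1 h2 h3; lra.
Unshelve. all: by end_near. Qed.

End Final.

(** * From the cluster bound to the stated constants *)

Lemma radius_exists (l : seq cell) : exists r, {in l, forall c, radius r c}.
Proof.
elim: l => [|c l [r lr]]; first by exists 0%N.
exists (r + \sum_i `|c.1 ord0 i|)%N => d; rewrite inE => /predU1P[->|dl]; last first.
  by apply: radius_le (lr _ dl); rewrite leq_addr.
move=> i; have : (`|c.1 ord0 i| <= r + \sum_i `|c.1 ord0 i|)%N.
  by rewrite (bigD1 i) //= addnCA leq_addr.
by move: (r + _)%N => m; move: (c.1 ord0 i) => x; clear; lia.
Qed.

Theorem proposition7p1 (R : realType) (n : nat) (n_ge2 : (2 <= n)%N)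
    (rho : 'Z_n -> R[i]) (rho_rep : faithful_unitary_rep rho)
    (beta kappa : R) (beta_ge0 : 0 <= beta) (kappa_ge0 : 0 <= kappa)
    (small : 18 ^+ 2 * alpha0 rho kappa * (2 + alpha0 rho kappa) < 1)
    (gamma : chain) (gamma_path : is_path gamma) :
  `| infinite_volume_expectation rho beta%:E kappa (L rho gamma)
     - infinite_volume_expectation rho +oo%E kappa (L rho gamma) |
  <= (2 * K4 rho kappa * (1 + K3 rho kappa * K4 rho kappa * alpha0 rho kappa)
      * (size (dom gamma))%:R * alpha0 rho kappa * alpha1 rho beta ^+ 6)%:C.
Proof.
have [gamma_edges _ _] := gamma_path; have [r gr] := radius_exists (dom gamma).
have a0 := alpha0_ge0 rho kappa; have p0 := pair_alpha_ge0 rho kappa.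
(* Here [18 ^+ 2 = 324], so the smallness hypothesis is exactly [324 * pair_alpha < 1]. *)
have pE : K4 rho kappa * alpha0 rho kappa = 324 * pair_alpha rho kappa.
  by rewrite /K4 /pair_alpha; ring.
have p1 : 324 * pair_alpha rho kappa < 1 by rewrite -pE /K4; move: small; lra.
have small' : pair_alpha rho kappa <= 1 / 324 by lra.
apply: le_trans (expectation_flat rho_rep small' gamma_edges gr beta_ge0) _.
rewrite lecR; have K3_ge0 : 0 <= K3 rho kappa.
  rewrite mulr_ge0 // invr_ge0.
  by move: p1; rewrite -pE /K4; lra.
set S := (size _)%:R; set A := alpha1 _ _ ^+ 6; set x := pair_alpha _ _ in p0 pE p1 *.
have S0 : 0 <= S by rewrite ler0n.
have A0 : 0 <= A by rewrite exprn_ge0 // alpha1_ge0.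
have -> : 2 * K4 rho kappa * (1 + K3 rho kappa * K4 rho kappa * alpha0 rho kappa) * S *
    alpha0 rho kappa * A = 2 * (K4 rho kappa * alpha0 rho kappa) *
    (1 + K3 rho kappa * (K4 rho kappa * alpha0 rho kappa)) * S * A by ring.
rewrite pE ler_wpM2r //.
have K0 : 0 <= K3 rho kappa * (324 * x) by apply: mulr_ge0 K3_ge0 _; apply: mulr_ge0 p0; apply: ler0n.
move: (K3 _ _ * _) K0 => k k0; rewrite -subr_ge0.
(* The target has leading coefficient [2 * 324 = 648] against the 8 just obtained, which leaves 640;
   the correction with [K3] only adds a non-negative term. *)
rewrite (_ : _ - _ = 640 * (x * S) + 648 * (x * S * k)); last by ring.
have xS : 0 <= x * S by apply: mulr_ge0.
by apply: addr_ge0; (apply: mulr_ge0; first exact: ler0n); last apply: mulr_ge0.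
Qed.
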